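(* For finite trees $S_1,S_2$ set $$d(S_1,S_2)=\lim_{n\to\infty}\mathrm{d_{TV}}\big(T_n^{(S_1)},T_n^{(S_2)}\big),$$ where $(T^{(S)}_n)_{n\ge |S|}$ denotes the linear preferential attachment model started from the seed tree $S$. Then the function $d$ is a metric on the set of finite trees (up to graph isomorphism) with at least $3$ vertices.
   Context: A tree is a finite connected graph without cycles, considered up to graph isomorphism; $|S|$ is the number of vertices of $S$. Linear preferential attachment model: given a seed tree $S$ with $|S|=n_0\ge 2$ vertices, $(T_n^{(S)})_{n\ge n_0}$ is the random sequence of trees with $T^{(S)}_{n_0}=S$ such that, for $n\ge n_0$, conditionally on $T^{(S)}_{n_0},\dots,T^{(S)}_n$, the tree $T_{n+1}^{(S)}$ is obtained from $T_n^{(S)}$ by joining with an edge a new vertex to a random vertex of $T_n^{(S)}$ chosen with probability proportional to its degree in $T_n^{(S)}$. Thus $T_n^{(S)}$ has $n$ vertices. $\mathrm{d_{TV}}$ is the total variation distance between the laws of random variables with values in the (countable) set of finite trees up to isomorphism; $\mathrm{d_{TV}}(T_n^{(S_1)},T_n^{(S_2)})$ is defined for $n\ge\max(|S_1|,|S_2|)$, and the limit exists since this quantity is non-increasing in $n$. *)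

(* Defs.v *)
From HB Require Import structures.
From mathcomp Require Import all_boot all_order all_algebra generic_quotient.
From mathcomp Require Import all_classical all_reals all_analysis.

Set Implicit Arguments.
Unset Strict Implicit.
Unset Printing Implicit Defensive.

Import Order.TTheory GRing.Theory Num.Theory.
Import numFieldNormedType.Exports.

Local Open Scope quotient_scope.
Local Open Scope classical_set_scope.
Local Open Scope ring_scope.

(* A finite labelled (di)graph: a number n of vertices together with a set of
   ordered pairs of elements of 'I_n.  Simplicity is part of [is_tree]. *)
Definition graph : Type := {n : nat & {set 'I_n * 'I_n}}.

Definition vertex (G : graph) : finType := 'I_(tag G).

Definition adj (G : graph) : rel (vertex G) :=
  fun x y => (x, y) \in tagged G.

Definition deg (G : graph) (v : vertex G) : nat := #|[pred w | adj v w]|.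

(* A cycle is a duplicate-free closed walk with at least 3 vertices; [ucycle]
   also accepts the empty walk and, along one edge, the walk [:: x; y]. *)
Definition is_tree (G : graph) : bool :=
  [&& (0 < tag G)%N,
      [forall x : vertex G, ~~ adj x x],
      [forall x : vertex G, forall y : vertex G, adj x y == adj y x],
      [forall x : vertex G, forall y : vertex G, connect (@adj G) x y] &
      `[< forall p : seq (vertex G),
            ucycle (@adj G) p -> (size p < 3)%N >] ].

Definition iso (G H : graph) : bool :=
  `[< exists2 f : vertex G -> vertex H, bijective f &
        forall x y, adj (f x) (f y) = adj x y >].

Lemma iso_refl : reflexive iso.
Proof. by move=> G; apply/asboolP; exists id => //; exists id. Qed.

Lemma iso_sym : symmetric iso.
Proof.
suff sym G H : iso G H -> iso H G by move=> G H; apply/idP/idP; exact: sym.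
move=> /asboolP[f [g fK gK] fadj]; apply/asboolP; exists g; first by exists f.
by move=> x y; rewrite -fadj !gK.
Qed.

Lemma iso_trans : transitive iso.
Proof.
move=> H G K /asboolP[f fbij fadj] /asboolP[g gbij gadj]; apply/asboolP.
exists (g \o f); first exact: bij_comp.
by move=> x y; rewrite /= gadj fadj.
Qed.

Definition labelled_tree : Type := {G : graph | is_tree G}.

Definition tree_iso : rel labelled_tree := fun t s => iso (val t) (val s).

Lemma tree_iso_refl : reflexive tree_iso.
Proof. by move=> t; exact: iso_refl. Qed.

Lemma tree_iso_sym : symmetric tree_iso.
Proof. by move=> t s; exact: iso_sym. Qed.

Lemma tree_iso_trans : transitive tree_iso.
Proof. by move=> t s u; exact: iso_trans. Qed.

Canonical tree_iso_equiv :=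
  EquivRel tree_iso tree_iso_refl tree_iso_sym tree_iso_trans.

(* Finite trees up to graph isomorphism. *)
Definition tree : Type := {eq_quot tree_iso}.
HB.instance Definition _ := Choice.on tree.

(* A labelled representative; what is defined from it below does not depend
   on the choice made by [repr]. *)
Definition rep (t : tree) : graph :=
  val (repr (t : {eq_quot tree_iso}) : labelled_tree).

Definition tree_size (t : tree) : nat := tag (rep t).

Definition single_vertex : graph :=
  Tagged (fun n => {set 'I_n * 'I_n}) (finset.set0 : {set 'I_1 * 'I_1}).

Lemma single_vertex_tree : is_tree single_vertex.
Proof.
apply/and5P; split => //.
- by apply/forallP => x; rewrite /adj inE.
- by apply/forallP => x; apply/forallP => y; rewrite /adj !inE.
- by apply/forallP => x; apply/forallP => y; rewrite (ord1 x) (ord1 y).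
- apply/asboolP => p /andP[_ /card_uniqP <-].
  by apply: leq_ltn_trans (max_card _) _; rewrite card_ord.
Qed.

HB.instance Definition _ := isPointed.Build tree
  (\pi_{eq_quot tree_iso} (exist _ single_vertex single_vertex_tree)).

HB.instance Definition _ := @isMeasurable.Build default_measure_display
  tree discrete_measurable discrete_measurable0
  discrete_measurableC discrete_measurableU.

(* The new vertex is [ord_max]; the old ones are embedded by [lift ord_max]. *)
Definition add_leaf (G : graph) (v : vertex G) : graph :=
  Tagged (fun n => {set 'I_n * 'I_n})
    [set e : 'I_(tag G).+1 * 'I_(tag G).+1 |
      match unlift ord_max e.1, unlift ord_max e.2 with
      | Some x, Some y => adj (x : vertex G) (y : vertex G)
      | Some x, None => x == v
      | None, Some y => y == v
      | None, None => false
      end]%SET.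

(* Probability that attaching a leaf to a vertex of t, chosen with probability
   proportional to its degree, produces the tree s. *)
Definition attach_prob (R : realType) (t s : tree) : R :=
  (\sum_(v : vertex (rep t) | iso (add_leaf v) (rep s)) (deg v)%:R)
    / \sum_(v : vertex (rep t)) (deg v)%:R.

(* T is a linear preferential attachment process started from the seed S, the
   conditional law of T n.+1 being given on each history of trees h.  The
   variables T n with n < tree_size S are irrelevant. *)
Definition is_lpam (d : measure_display) (Omega : measurableType d)
    (R : realType) (P : probability Omega R) (S : tree)
    (T : nat -> {RV P >-> tree}) : Prop :=
  {ae P, forall w, T (tree_size S) w = S} /\
  forall (n : nat) (h : nat -> tree) (s : tree), (tree_size S <= n)%N ->
    let history :=
      [set w | forall i, (tree_size S <= i <= n)%N -> T i w = h i] in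
    P (history `&` [set w | T n.+1 w = s])
      = (P history * (attach_prob R (h n) s)%:E)%E.

Definition tv_dist (d : measure_display) (X : measurableType d)
    (R : realType) (mu nu : probability X R) : R :=
  sup [set `|fine (mu A) - fine (nu A)| | A in (measurable : set (set X))].

(* Total variation distance between the laws of T1 n and T2 n. *)
Definition tv_seq (d1 d2 : measure_display) (Omega1 : measurableType d1)
    (Omega2 : measurableType d2) (R : realType) (P1 : probability Omega1 R)
    (P2 : probability Omega2 R) (T1 : nat -> {RV P1 >-> tree})
    (T2 : nat -> {RV P2 >-> tree}) (n : nat) : R :=
  tv_dist (distribution P1 (T1 n)) (distribution P2 (T2 n)).

Definition is_metric_on (X : Type) (R : realType) (D : set X)
    (dist : X -> X -> R) : Prop :=
  [/\ forall x y, D x -> D y -> 0 <= dist x y,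
      forall x y, D x -> D y -> (dist x y = 0 <-> x = y),
      forall x y, D x -> D y -> dist x y = dist y x &
      forall x y z, D x -> D y -> D z -> dist x z <= dist x y + dist y z].

(* Main.v *)
(* Only positivity of d(S1, S2) for S1 <> S2 is hard.  Write [k]^(q) for the
   rising factorial k (k+1) ... (k+q-1).  For a graph with vertex set J and
   weights w >= 3 on J, let D_{J,w}(T) be the sum over the embeddings f of J in
   T of prod_i [deg f(i)]^(w i).  Since k [k+1]^(q) = [k]^(q) (k + q), one step
   of the process multiplies E D_{J,w} by 1 + |w| / (2 (n - 1)), up to a
   combination of D_{J',w'} with fewer vertices and again w' >= 3.

   If |S1| <= |S2| = m, then D_{S2,3} vanishes on the trees of size m other than
   S2, and P(T_m^(S1) = S2) < 1 because attaching a leaf at vertices of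
   different degrees gives different trees.  So the two seeds give different
   means to some D_{J,w} at time m.  For such a D_{J,w} with |J| minimal the
   lower-order terms cancel, so that the difference of the means is exactly
   multiplicative in n and grows like n^(|w| / 2).

   The second moment of D_{J,w} is O(n^|w|): forgetting adjacency and
   injectivity bounds D_{J,w} by a product of the power sums
   X_a = sum_v [deg v]^(a) with a >= 3, and E X_a^p = O(n^(a p / 2)) follows
   from an exact recursion for the coefficients of the generating polynomial
   prod_v sum_j [deg v]^(a j) x^j / j!.  By Cauchy-Schwarz the total variation
   distance stays bounded away from 0. *)

Require Import Defs.
From HB Require Import structures.
From mathcomp Require Import all_boot all_order all_algebra generic_quotient.
From mathcomp Require Import all_classical all_reals all_analysis.
From mathcomp Require Import ring lra zify.

Set Implicit Arguments.
Unset Strict Implicit.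
Unset Printing Implicit Defensive.

Import Order.TTheory GRing.Theory Num.Theory.
Import numFieldNormedType.Exports.

(** * Rising factorials and weighted embedding counts *)

Definition rise (k q : nat) : nat := \prod_(i < q) (k + i).

Lemma rise0 k : rise k 0 = 1.
Proof. by rewrite /rise big_ord0. Qed.

Lemma riseS k q : rise k q.+1 = rise k q * (k + q).
Proof. by rewrite /rise big_ord_recr. Qed.

Lemma riseSl k q : rise k q.+1 = k * rise k.+1 q.
Proof.
rewrite /rise big_ord_recl addn0; congr (_ * _).
by apply: eq_bigr => i _; rewrite lift0 addSnnS.
Qed.

Lemma rise_succ k q : k * rise k.+1 q = rise k q * (k + q).
Proof. by rewrite -riseSl riseS. Qed.

Lemma rise_one q : rise 1 q = q`!.
Proof. by elim: q => [|q IH]; rewrite ?rise0 // riseS IH factS mulnC. Qed.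

Lemma riseD k p q : rise k (p + q) = rise k p * rise (k + p) q.
Proof.
elim: q => [|q IH]; first by rewrite addn0 rise0 muln1.
by rewrite addnS !riseS IH -mulnA addnA.
Qed.

Lemma leq_rise k k' q : k <= k' -> rise k q <= rise k' q.
Proof. by move=> le; apply: leq_prod => i _; rewrite leq_add2r. Qed.

Lemma leq_riseM k p q : rise k p * rise k q <= rise k (p + q).
Proof. by rewrite riseD leq_mul2l leq_rise ?orbT ?leq_addr. Qed.

Lemma leq_expn_rise k q : k ^ q <= rise k q.
Proof.
elim: q => [|q IH]; first by rewrite rise0.
by rewrite expnSr riseS leq_mul ?leq_addr.
Qed.

Lemma rise_gt0 k q : 0 < k -> 0 < rise k q.
Proof. by move=> k0; apply: prodn_gt0 => i; rewrite addn_gt0 k0. Qed.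

Lemma big_option (R : Type) (idx : R) (op : Monoid.com_law idx) (V : finType)
    (f : option V -> R) :
  \big[op/idx]_x f x = op (f None) (\big[op/idx]_v f (Some v)).
Proof.
rewrite (bigD1 None) //=; congr (op _ _).
rewrite (reindex_omap Some id) /=; last by case.
by apply: eq_bigl => v; rewrite eqxx.
Qed.

(** * Weighted embedding counts and their change when a leaf is attached *)

Section Embeddings.
Variables (I : finType) (e : rel I).
Implicit Types (J : {set I}) (w : I -> nat) (V : finType).

(** Partial maps with domain exactly [J] keep all vertex sets in one function type, so that deleting
    a vertex of [J] changes neither [I] nor [e]. Edges must be preserved, not reflected. *)
Definition embeds V (a : rel V) J (f : {ffun I -> option V}) : bool :=
  `[< [/\ forall i, isSome (f i) = (i \in J),
          {in J &, injective f} &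
          forall i j x y, f i = Some x -> f j = Some y -> e i j -> a x y] >].

Definition emb_weight V (d : V -> nat) J w (f : {ffun I -> option V}) : nat :=
  \prod_(i in J) rise (oapp d 0 (f i)) (w i).

Definition emb_sum V (a : rel V) (d : V -> nat) J w : nat :=
  \sum_(f : {ffun I -> option V} | embeds a J f) emb_weight d J w f.

(** [None] stands for the new leaf, which spares the index arithmetic of [add_leaf]. *)
Definition grow_adj V (a : rel V) (v : V) : rel (option V) := fun x y =>
  match x, y with
  | Some x, Some y => a x y
  | Some x, None => x == v
  | None, Some y => y == v
  | None, None => false
  end.

Definition grow_deg V (d : V -> nat) (v : V) (x : option V) : nat :=
  if x is Some x then d x + (x == v) else 1.

Lemma emb_sum_iso V V' (a : rel V) (a' : rel V') d d' J w (h : V -> V') :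
  bijective h -> (forall x y, a' (h x) (h y) = a x y) ->
  (forall x, d' (h x) = d x) -> emb_sum a' d' J w = emb_sum a d J w.
Proof.
move=> [g hK gK] ha hd; rewrite /emb_sum.
rewrite (reindex_onto (fun f : {ffun I -> option V} => [ffun i => omap h (f i)])
  (fun f : {ffun I -> option V'} => [ffun i => omap g (f i)])) /=; last first.
  move=> f _; apply/ffunP => i; rewrite !ffunE.
  by case: (f i) => //= x; rewrite gK.
apply: eq_big => f; last first.
  move=> _; apply: eq_bigr => i _; rewrite ffunE.
  by case: (f i) => //= x; rewrite hd.
rewrite andb_idr; last first.
  move=> _; apply/eqP/ffunP => i; rewrite !ffunE.
  by case: (f i) => //= x; rewrite hK.
apply/asboolP/asboolP => -[f1 f2 f3]; split.
- by move=> i; rewrite -f1 ffunE; case: (f i).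
- by move=> i j iJ jJ fij; apply: f2 => //; rewrite !ffunE fij.
- move=> i j x y fi fj eij; rewrite -ha; apply: f3 eij; rewrite ffunE.
  + by rewrite fi.
  + by rewrite fj.
- by move=> i; rewrite -f1 ffunE; case: (f i).
- move=> i j iJ jJ; rewrite !ffunE => fij; apply: f2 => //.
  case: (f i) (f j) fij => [x|] [y|] //= [].
  by move/(can_inj hK) ->.
- move=> i j x y; rewrite !ffunE.
  case fi: (f i) => [x'|] //= [<-]; case fj: (f j) => [y'|] //= [<-] eij.
  by rewrite ha; apply: f3 eij.
Qed.

(** By injectivity at most one [i] in [J] sits at [v]. If there is one, [rise_succ] absorbs the
    factor [d v] and produces [d v + w i]; otherwise no factor changes. *)
Lemma emb_weight_grow V (a : rel V) (d : V -> nat) J w f (v : V) : embeds a J f ->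
  d v * \prod_(i in J) rise (oapp (fun x => d x + (x == v)) 0 (f i)) (w i)
  = (d v + \sum_(i in J | f i == Some v) w i) * emb_weight d J w f.
Proof.
move=> /asboolP[f1 f2 _]; rewrite /emb_weight.
have [/existsP[i0 /andP[i0J /eqP fi0]]|] :=
  boolP [exists i, (i \in J) && (f i == Some v)].
- rewrite [\sum_(i in J | _) _](big_pred1 i0); last first.
    move=> i /=; apply/andP/eqP => [[iJ /eqP fi]|->]; last by rewrite i0J fi0.
    by apply: f2 => //; rewrite fi fi0.
  rewrite (bigD1 i0) //= [in RHS](bigD1 i0) //= fi0 /= eqxx addn1 !mulnA.
  rewrite rise_succ; congr (_ * _); first by rewrite mulnC.
  apply: eq_bigr => i /andP[iJ ii0]; congr rise.
  case fi: (f i) => [x|] //=; case: eqP => [xv|]; rewrite ?addn0 //.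
  by case/eqP: ii0; apply: f2 => //; rewrite fi fi0 xv.
- rewrite negb_exists => /forallP nf.
  rewrite [\sum_(i in J | _) _]big1 ?addn0; last first.
    by move=> i /andP[iJ fi]; move: (nf i); rewrite iJ fi.
  congr (_ * _); apply: eq_bigr => i iJ; congr rise.
  have := nf i; rewrite iJ /=; case: (f i) => [x|] //=.
  by rewrite (inj_eq Some_inj) => /negbTE ->; rewrite addn0.
Qed.

(** [put] and [put_new u] describe the embeddings that avoid the new vertex and those that send [u]
    to it; [strip] goes back by forgetting the new vertex. *)
Let strip V (f : {ffun I -> option (option V)}) : {ffun I -> option V} :=
  [ffun i => oapp id None (f i)].

Let put V (f : {ffun I -> option V}) : {ffun I -> option (option V)} :=
  [ffun i => omap Some (f i)].

Let put_new V u (f : {ffun I -> option V}) : {ffun I -> option (option V)} :=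
  [ffun i => if i == u then Some None else omap Some (f i)].

Let new_at V (f : {ffun I -> option (option V)}) u := f u == Some None.

Hypothesis e_sym : symmetric e.

Let emb_put V (a : rel V) v J f :
  embeds (grow_adj a v) J (put f) = embeds a J f.
Proof.
apply/asboolP/asboolP => -[f1 f2 f3]; split.
- by move=> i; rewrite -f1 ffunE; case: (f i).
- by move=> i j iJ jJ fij; apply: f2 => //; rewrite !ffunE fij.
- move=> i j x y fi fj; apply: (f3 i j (Some x) (Some y)); rewrite ffunE.
  + by rewrite fi.
  + by rewrite fj.
- by move=> i; rewrite -f1 ffunE; case: (f i).
- move=> i j iJ jJ; rewrite !ffunE => fij; apply: f2 => //.
  by case: (f i) (f j) fij => [x|] [y|] //= [->].
- move=> i j x y; rewrite !ffunE.
  case fi: (f i) => [x'|] //= [<-]; case fj: (f j) => [y'|] //= [<-] eij.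
  exact: f3 eij.
Qed.

(** The new leaf has [v] as its only neighbour, so [u] may be sent there exactly when all neighbours
    of [u] in [J] are sent to [v]. A loop at [u] makes both sides false. *)
Let emb_put_new V (a : rel V) v J u f : u \in J ->
  embeds (grow_adj a v) J (put_new u f) && (strip (put_new u f) == f)
  = embeds a (J :\ u) f && [forall j in J, e u j ==> (f j == Some v)].
Proof.
move=> uJ; apply/andP/andP.
- case=> /asboolP[f1 f2 f3] /eqP sf.
  have fu : f u = None by rewrite -sf !ffunE eqxx.
  split; last first.
    apply/forall_inP => j jJ; apply/implyP => euj.
    have := f1 j; have := f3 u j None; rewrite !ffunE eqxx jJ.
    case: (eqVneq j u) => [ju|ju]; first by move=> /(_ None erefl erefl euj).
    case: (f j) => [x|] //= /(_ (Some x) erefl erefl euj) /=.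
    by rewrite (inj_eq Some_inj).
  apply/asboolP; split.
  + move=> i; rewrite !inE -f1 ffunE; case: eqP => [->|_]; first by rewrite fu.
    by case: (f i).
  + move=> i j; rewrite !inE => /andP[iu iJ] /andP[ju jJ] fij.
    by apply: f2 => //; rewrite !ffunE (negbTE iu) (negbTE ju) fij.
  + move=> i j x y fi fj eij; apply: (f3 i j (Some x) (Some y)) eij; rewrite ffunE.
    * by case: eqP => [iu|_]; [rewrite iu fu in fi | rewrite fi].
    * by case: eqP => [iu|_]; [rewrite iu fu in fj | rewrite fj].
- case=> /asboolP[f1 f2 f3] /forall_inP nb.
  have fu : f u = None by have := f1 u; rewrite !inE eqxx /=; case: (f u).
  have nb' j y : f j = Some y -> e u j -> y = v.
    move=> fj euj; have jJ : j \in J.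
      by have := f1 j; rewrite fj !inE => /esym /andP[].
    by have := nb j jJ; rewrite euj fj /= => /eqP[].
  have nuu : e u u = false.
    by apply/negP => euu; have := nb u uJ; rewrite euu fu.
  split; last first.
    apply/eqP/ffunP => i; rewrite !ffunE.
    by case: eqP => [->|_]; [rewrite fu|case: (f i)].
  apply/asboolP; split.
  + move=> i; rewrite ffunE; case: eqP => [->|/eqP iu] /=; first by rewrite uJ.
    by have := f1 i; rewrite !inE iu /= => <-; case: (f i).
  + move=> i j iJ jJ; rewrite !ffunE.
    case: eqP => [->|/eqP iu]; case: eqP => [->|/eqP ju] //.
    * by case: (f j).
    * by case: (f i).
    * move=> fij; apply: f2; rewrite ?inE ?iu ?ju //.
      by case: (f i) (f j) fij => [x|] [y|] //= [->].
  + move=> i j x y; rewrite !ffunE.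
    case: (eqVneq i u) => [-> [<-]|iu].
      case: (eqVneq j u) => [-> _|ju]; first by rewrite nuu.
      by case fj: (f j) => [z|] //= [<-] euj; rewrite (nb' j z).
    case fi: (f i) => [x'|] //= [<-].
    case: (eqVneq j u) => [-> [<-]|ju] /=.
      by rewrite e_sym => eui; rewrite (nb' i x').
    case fj: (f j) => [y'|] //= [<-] eij.
    exact: f3 eij.
Qed.

(* An embedding into the grown tree uses the new vertex at most once. *)
Lemma emb_sum_split V (a : rel V) (d : V -> nat) v J w :
  emb_sum (grow_adj a v) (grow_deg d v) J w =
  \sum_(f | embeds a J f)
     \prod_(i in J) rise (oapp (fun x => d x + (x == v)) 0 (f i)) (w i) +
  \sum_(u in J) (w u)`! *
     \sum_(f | embeds a (J :\ u) f && [forall j in J, e u j ==> (f j == Some v)])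
       \prod_(i in J :\ u) rise (oapp (fun x => d x + (x == v)) 0 (f i)) (w i).
Proof.
rewrite /emb_sum (bigID (fun f => [exists u in J, new_at f u])) /= addnC.
congr (_ + _).
- rewrite (reindex_onto (@put V) (@strip V)) /=; last first.
    move=> f /andP[/asboolP[f1 _ _]]; rewrite negb_exists => /forallP nf.
    apply/ffunP => i; rewrite !ffunE; have := nf i; rewrite /new_at -f1.
    by case: (f i) => [[x|]|].
  apply: eq_big => f.
    rewrite emb_put -andbA andb_idr // => _; apply/andP; split.
      rewrite negb_exists; apply/forallP => i; rewrite negb_and /new_at ffunE.
      by apply/orP; right; case: (f i).
    by apply/eqP/ffunP => i; rewrite !ffunE; case: (f i).
  by move=> _; apply: eq_bigr => i _; rewrite ffunE; case: (f i).
(* The inner sum has one term if [f] uses the new leaf and none otherwise; exchanging the sums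
   classifies the embeddings by the vertex [u] sent there. *)
- transitivity (\sum_(f | embeds (grow_adj a v) J f)
      \sum_(u in J | new_at f u) emb_weight (grow_deg d v) J w f).
    rewrite [RHS](bigID (fun f => [exists u in J, new_at f u])) /=.
    rewrite [X in _ = _ + X]big1 ?addn0; last first.
      move=> f /andP[_]; rewrite negb_exists => /forallP nf.
      by rewrite big1 // => u /andP[uJ fu]; have := nf u; rewrite uJ fu.
    apply: eq_bigr => f /andP[/asboolP[_ f2 _] /existsP[u /andP[uJ fu]]].
    rewrite (big_pred1 u) // => i /=; apply/andP/eqP => [[iJ /eqP fi]|->] //.
    by apply: f2 => //; rewrite fi (eqP fu).
  rewrite (exchange_big_dep (fun u => u \in J)) /=; last by move=> f u _ /andP[].
  apply: eq_bigr => u uJ.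
  under eq_bigl => f do rewrite uJ /=.
  rewrite big_distrr /= (reindex_onto (@put_new V u) (@strip V)) /=; last first.
    move=> f /andP[/asboolP[f1 f2 _] fu]; apply/ffunP => i; rewrite !ffunE.
    case: eqP => [->|/eqP iu]; first by rewrite (eqP fu).
    case fi: (f i) => [[x|]|] //=; case/eqP: iu; apply: f2 => //.
      by rewrite -f1 fi.
    by rewrite fi (eqP fu).
  apply: eq_big => f.
    rewrite -andbA andbCA /new_at ffunE eqxx /=.
    exact: emb_put_new.
  move=> _; rewrite /emb_weight (big_setD1 u) //=; congr (_ * _).
    by rewrite ffunE eqxx /= rise_one.
  apply: eq_bigr => i; rewrite !inE ffunE => /andP[/negbTE -> _].
  by case: (f i).
Qed.

(** Degree-weighted contribution of the embeddings that send [u] to the new leaf; the factorial is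
    [1]^(w u), the weight of a vertex of degree 1. *)
Definition branch V (a : rel V) (d : V -> nat) J w u : nat :=
  (w u)`! * \sum_v d v *
   \sum_(f | embeds a (J :\ u) f && [forall j in J, e u j ==> (f j == Some v)])
       \prod_(i in J :\ u) rise (oapp (fun x => d x + (x == v)) 0 (f i)) (w i).

(* Rising factorials make attachment diagonal:
   [d * rise d.+1 q = rise d q * (d + q)]. *)
Lemma emb_sum_grow V (a : rel V) (d : V -> nat) J w :
  \sum_v d v * emb_sum (grow_adj a v) (grow_deg d v) J w =
  (\sum_v d v + \sum_(i in J) w i) * emb_sum a d J w +
  \sum_(u in J) branch a d J w u.
Proof.
under eq_bigr => v _ do rewrite emb_sum_split mulnDr.
rewrite big_split /=; congr (_ + _).
  under eq_bigr => v _ do rewrite big_distrr /=.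
  rewrite exchange_big /= /emb_sum big_distrr /=; apply: eq_bigr => f ef.
  under eq_bigr => v _ do rewrite (emb_weight_grow d w v ef).
  rewrite -big_distrl /= big_split /=; congr ((_ + _) * _).
  rewrite (exchange_big_dep (fun i => i \in J)) /=; last by move=> v i _ /andP[].
  case/asboolP: ef => f1 _ _.
  apply: eq_bigr => i iJ; have := f1 i; rewrite iJ; case: (f i) => // x _.
  by rewrite (big_pred1 x) // => v; rewrite eq_sym.
under eq_bigr => v _ do rewrite big_distrr /=.
rewrite exchange_big /=; apply: eq_bigr => u uJ; rewrite /branch big_distrr /=.
by apply: eq_bigr => v _; rewrite mulnCA.
Qed.

Lemma branch_isolated V (a : rel V) (d : V -> nat) J w u :
  (forall j, j \in J -> ~~ e u j) ->
  branch a d J w u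
  = (w u)`! * ((\sum_v d v + \sum_(i in J :\ u) w i) * emb_sum a d (J :\ u) w).
Proof.
move=> nu; rewrite /branch; congr (_ * _).
have cT f v : [forall j in J, e u j ==> (f j == Some v :> option V)].
  by apply/forall_inP => j /nu /negbTE ->.
under eq_bigr => v _ do (under eq_bigl => f do rewrite cT andbT).
under eq_bigr => v _ do rewrite big_distrr /=.
rewrite exchange_big /= /emb_sum big_distrr /=; apply: eq_bigr => f ef.
under eq_bigr => v _ do rewrite (emb_weight_grow d w v ef).
rewrite -big_distrl /= big_split /=; congr ((_ + _) * _).
rewrite (exchange_big_dep (fun i => i \in J :\ u)) /=; last by move=> v i _ /andP[].
case/asboolP: ef => f1 _ _.
apply: eq_bigr => i iJ; have := f1 i; rewrite iJ; case: (f i) => // x _.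
by rewrite (big_pred1 x) // => v; rewrite eq_sym.
Qed.

(** The unique neighbour [t] must sit at [v], so the sum over [v] collapses, and the factor [d v]
    raises the exponent of [t] by one. Exponents never drop, which keeps them at least 3. *)
Lemma branch_leaf V (a : rel V) (d : V -> nat) J w u t :
  t \in J -> t != u -> e u t -> (forall j, j \in J -> e u j -> j = t) ->
  branch a d J w u
  = (w u)`! * emb_sum a d (J :\ u) (fun i => w i + (i == t)).
Proof.
move=> tJ tu eut ut; rewrite /branch; congr (_ * _).
have tJu : t \in J :\ u by rewrite !inE tu.
have cT f v : [forall j in J, e u j ==> (f j == Some v :> option V)] = (f t == Some v).
  apply/forall_inP/idP => [/(_ t tJ)|ft j jJ]; first by rewrite eut.
  by apply/implyP => /ut ->.
under eq_bigr => v _ do (under eq_bigl => f do rewrite cT).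
under eq_bigr => v _ do rewrite big_distrr /=.
rewrite (exchange_big_dep (fun f => embeds a (J :\ u) f)) /=; last first.
  by move=> v f _ /andP[].
rewrite /emb_sum; apply: eq_bigr => f ef; rewrite ef /=.
have /asboolP[f1 f2 _] := ef.
have := f1 t; rewrite tJu; case ft: (f t) => [x|] // _.
rewrite (big_pred1 x); last by move=> v; rewrite eq_sym.
rewrite (emb_weight_grow d w x ef) [\sum_(i in _ | _) _](big_pred1 t); last first.
  move=> i /=; apply/andP/eqP => [[iJ /eqP fi]|->]; last by rewrite ft.
  by apply: f2 => //; rewrite fi ft.
rewrite /emb_weight (big_setD1 t) //= [in RHS](big_setD1 t) //= ft /= eqxx addn1.
rewrite riseS mulnA [(_ + _) * _]mulnC; congr (_ * _).
by apply: eq_bigr => i; rewrite 2!inE => /andP[/negbTE -> _]; rewrite addn0.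
Qed.

(** The last hypothesis says that [t] and [t'] are distinct or give a loop at [u]. Either two
    vertices would be sent to [v], or [u] would have to be mapped although it has left the
    domain. *)
Lemma branch_many V (a : rel V) (d : V -> nat) J w u t t' :
  t \in J -> t' \in J -> e u t -> e u t' -> (t == t') ==> (t == u) ->
  branch a d J w u = 0.
Proof.
move=> tJ t'J eut eut' tt'; rewrite /branch big1 ?muln0 // => v _.
rewrite big_pred0 ?muln0 // => f; apply/negP => /andP[/asboolP[f1 f2 _] /forall_inP c].
have /eqP ft : f t == Some v by have := c t tJ; rewrite eut.
have /eqP ft' : f t' == Some v by have := c t' t'J; rewrite eut'.
have tJu : t \in J :\ u by rewrite -f1 ft.
have t'Ju : t' \in J :\ u by rewrite -f1 ft'.
have ett : t = t' by apply: f2 => //; rewrite ft ft'.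
by move: tt'; rewrite ett eqxx => /eqP tu; move: t'Ju; rewrite tu !inE eqxx.
Qed.

(** Expanding the product of sums gives one term for each partial map with domain [J], and the
    embeddings are some of these maps. *)
Lemma emb_sum_le V (a : rel V) (d : V -> nat) J w :
  emb_sum a d J w <= \prod_(i in J) \sum_v rise (d v) (w i).
Proof.
have -> : \prod_(i in J) \sum_v rise (d v) (w i) =
  \prod_(i in J) \sum_(x : option V | isSome x) rise (oapp d 0 x) (w i).
  apply: eq_bigr => i _; rewrite (reindex_omap Some id) /=; last by case.
  by apply: eq_bigl => v; rewrite eqxx.
rewrite (big_distr_big_dep None) /=.
rewrite /emb_sum /emb_weight.
rewrite [leqRHS](bigID (embeds a J)) /=; apply: leq_trans (leq_addr _ _).
rewrite leq_eqVlt; apply/orP; left; apply/eqP; apply: eq_bigl => f.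
rewrite andb_idl // => /asboolP[f1 _ _]; apply/pfamilyP; split.
  by apply/fintype.subsetP => i; rewrite !inE => fi; rewrite -f1; case: (f i) fi.
by move=> i iJ; rewrite unfold_in f1.
Qed.

End Embeddings.

(** * Trees *)

Lemma is_treeP (G : graph) :
  reflect [/\ (0 < tag G)%N, irreflexive (@adj G), symmetric (@adj G),
              forall x y : vertex G, connect (@adj G) x y &
              forall p : seq (vertex G), ucycle (@adj G) p -> (size p < 3)%N]
          (is_tree G).
Proof.
apply: (iffP and5P) => -[G0 irr sym con acyc]; split=> //.
- by move=> x; apply/negbTE; move/forallP: irr.
- by move=> x y; apply/eqP; move/forallP/(_ x)/forallP: sym; apply.
- by move=> x y; move/forallP/(_ x)/forallP: con; apply.
- exact/asboolP.
- by apply/forallP => x; rewrite irr.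
- by apply/forallP => x; apply/forallP => y; rewrite sym.
- by apply/forallP => x; apply/forallP => y; exact: con.
- exact/asboolP.
Qed.

Lemma degE (G : graph) (v : vertex G) : deg v = \sum_w adj v w.
Proof. by rewrite /deg -sum1_card big_mkcond. Qed.

Lemma connect_exit (V : finType) (e : rel V) (A : {set V}) x y :
  connect e x y -> x \in A -> y \notin A ->
  exists u v, [/\ u \in A, v \notin A & e u v].
Proof.
move=> /connectP[p]; elim: p x => [|z p IH] x /=; first by move=> _ -> ->.
move=> /andP[exz pz] yl xA yA; case: (boolP (z \in A)) => zA; last by exists x, z.
exact: (IH z pz yl zA yA).
Qed.

(* A vertex outside a connected set has at most one neighbour in it, as two
   would close a cycle. *)
Lemma tree_grow_set (G : graph) (k : nat) : is_tree G -> (k < tag G)%N ->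
  exists A : {set vertex G},
    [/\ #|A| = k.+1,
        {in A &, forall x y,
          connect [rel u v | [&& adj u v, u \in A & v \in A]] x y} &
        \sum_(x in A) \sum_(y in A) adj x y = k.*2].
Proof.
move=> /is_treeP[G0 irr sym con acyc]; elim: k => [|k IH] kG.
  exists [set Ordinal G0]%SET; split; first by rewrite cards1.
    by move=> x y /set1P -> /set1P ->; exact: connect0.
  by rewrite !big_set1 irr.
have [A [cA conA sA]] := IH (ltnW kG).
have [r rA] : exists r, r \in A by apply/card_gt0P; rewrite cA.
have [z zA] : exists z : vertex G, z \notin A.
  apply/existsP; rewrite -negb_forall; apply/negP => /forallP AT.
  have : #|A| = tag G by rewrite -[RHS]card_ord; apply: eq_card => x; rewrite AT.
  by rewrite cA => Ek; rewrite Ek ltnn in kG.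
have [y [x [yA xA eyx]]] := connect_exit (con r z) rA zA.
(* A simple path inside [A] from [t] to [y], closed up through [x], is a cycle; it has fewer than 3
   vertices only if [t] is [y]. *)
have nbr t : t \in A -> adj x t -> t = y.
  move=> tA ext; apply/eqP/negPn/negP => ty.
  have /connectP[p0 pp0] := conA _ _ tA yA.
  case: (shortenP pp0) => p pp up _ yp {p0 pp0}.
  have pA : {subset t :: p <= A}.
    move=> s; rewrite inE => /predU1P[-> //|].
    elim: p t {up yp ext ty tA} pp => //= s' p IHp t /andP[/and3P[_ _ s'A] ps'].
    by rewrite inE => /predU1P[-> //|]; exact: IHp ps'.
  have : (size (x :: t :: p) < 3)%N.
    apply: acyc; rewrite /ucycle; apply/andP; split; last first.
      by rewrite [uniq _]/= -/(uniq (t :: p)) up andbT; apply: contra xA => /pA.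
    rewrite /= ext rcons_path -yp eyx andbT.
    by apply: sub_path pp => a b /and3P[].
  by case: p yp {pp up pA} => //= yt; rewrite yt eqxx in ty.
pose A' := (x |: A)%SET.
have AA' : {subset A <= A'} by move=> s inA; rewrite !inE inA orbT.
have sub : subrel [rel u v | [&& adj u v, u \in A & v \in A]]
    (connect [rel u v | [&& adj u v, u \in A' & v \in A']]).
  by move=> u v /and3P[euv uA vA]; apply: connect1; rewrite /= euv !AA'.
have xA' : x \in A' by rewrite !inE eqxx.
have yA' := AA' y yA.
exists A'; split; first by rewrite cardsU1 xA cA.
- have cy u : u \in A' -> connect [rel u v | [&& adj u v, u \in A' & v \in A']] u y /\
     connect [rel u v | [&& adj u v, u \in A' & v \in A']] y u.
    rewrite inE => /orP[/set1P ->|uA].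
      by split; apply: connect1; rewrite /= ?xA' ?yA' ?eyx // sym eyx.
    by split; apply: (connect_sub sub); exact: conA.
  move=> u v /cy[uy _] /cy[_ yv]; exact: connect_trans uy yv.
- have E (F : vertex G -> nat) : \sum_(t in A') F t = F x + \sum_(t in A) F t.
    by rewrite /A' big_setU1.
  rewrite E; under [X in _ + X]eq_bigr => t _ do rewrite E.
  (* The single edge from [x] to [A] is counted at both ends, which adds 2 to the sum. *)
  have N : \sum_(t in A) adj x t = 1.
    rewrite (bigD1 y) //= sym eyx big1 ?addn0 // => t /andP[tA ty].
    by apply/eqP; rewrite eqb0; apply: contra ty => /(nbr _ tA) ->.
  rewrite E irr add0n N big_split /= sA.
  under eq_bigr => t _ do rewrite sym.
  by rewrite N doubleS; lia.
Qed.

Lemma sum_deg_tree (G : graph) : is_tree G -> \sum_(v : vertex G) deg v = (tag G).-1.*2.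
Proof.
move=> tG; have /is_treeP[G0 _ _ _ _] := tG.
have [|A [cA _ <-]] := @tree_grow_set G (tag G).-1 tG; first by rewrite prednK.
have -> : A = [set: vertex G]%SET.
  by apply/eqP; rewrite eqEcard finset.subsetT cA prednK //= cardsT card_ord.
apply: eq_big => [v|v _]; first by rewrite inE.
rewrite degE; apply: eq_bigl => w; by rewrite inE.
Qed.

(** * Attaching a leaf, with the new vertex read as [None] *)

Definition leaf_vertex (n : nat) (x : option 'I_n) : 'I_n.+1 :=
  oapp (lift ord_max) ord_max x.

Lemma leaf_vertexK n : cancel (@leaf_vertex n) (unlift ord_max).
Proof. by case=> [x|] /=; rewrite ?liftK ?unlift_none. Qed.

Lemma unlift_maxK n : cancel (unlift ord_max) (@leaf_vertex n).
Proof. by move=> x; case: unliftP => [j ->|->]. Qed.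

Lemma leaf_vertex_bij n : bijective (@leaf_vertex n).
Proof. by exists (unlift ord_max); [exact: leaf_vertexK|exact: unlift_maxK]. Qed.

Section AddLeaf.
Variables (G : graph) (v : vertex G).

Lemma add_leaf_adj (x y : option (vertex G)) :
  @adj (add_leaf v) (leaf_vertex x) (leaf_vertex y) = grow_adj (@adj G) v x y.
Proof.
rewrite /adj inE /= (leaf_vertexK x) (leaf_vertexK y).
by case: x y => [x|] [y|].
Qed.

Lemma add_leaf_deg (x : option (vertex G)) :
  @deg (add_leaf v) (leaf_vertex x) = grow_deg (@deg G) v x.
Proof.
rewrite degE (reindex (@leaf_vertex (tag G))) /=; last exact/onW_bij/leaf_vertex_bij.
under eq_bigr => y _ do rewrite add_leaf_adj.
rewrite big_option; case: x => [x|] /=; first by rewrite degE addnC.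
by rewrite (bigD1 v) //= eqxx big1 ?addn0 ?add0n // => y /negbTE ->.
Qed.

Lemma add_leaf_tree : is_tree G -> is_tree (add_leaf v).
Proof.
move=> /is_treeP[G0 irr sym con acyc]; pose h := @leaf_vertex (tag G).
have hW (Q : vertex (add_leaf v) -> Prop) : (forall x, Q (h x)) -> forall x, Q x.
  by move=> Qh x; rewrite -(unlift_maxK x); exact: Qh.
have adjh x y : @adj (add_leaf v) (h x) (h y) = grow_adj (@adj G) v x y.
  exact: add_leaf_adj.
pose hS (x : vertex G) : vertex (add_leaf v) := h (Some x).
have adjS : {mono hS : a b / @adj G a b >-> @adj (add_leaf v) a b}.
  by move=> a b; exact: (adjh (Some a) (Some b)).
have sym' : symmetric (@adj (add_leaf v)).
  apply: (hW _) => x; apply: (hW _) => y; rewrite !adjh.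
  by case: x y => [x|] [y|] //=; exact: sym.
apply/is_treeP; split => //.
- by apply: (hW _) => x; rewrite adjh; case: x => //= x; exact: irr.
- have cv x : connect (@adj (add_leaf v)) (h x) (h (Some v)).
    case: x => [x|]; last by apply: connect1; rewrite adjh /= eqxx.
    have /connectP[p pp vl] := con x v.
    apply/connectP; exists (map hS p); last by rewrite (last_map hS) -vl.
    by move: pp; rewrite -(mono_path adjS).
  apply: (hW _) => x; apply: (hW _) => y; apply: connect_trans (cv x) _.
  by rewrite (sym_connect_sym sym').
(* A cycle through the new leaf, rotated to start there, would have [v] both as its second and as
   its last vertex; a cycle avoiding the leaf lies in [G]. *)
- move=> p; have [newp|newp] := boolP (h None \in p).
    have [i p' rp] := rot_to newp.
    rewrite -(rot_ucycle i) -(size_rot i) rp /ucycle => /andP[].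
    case: p' {rp} => [|y p'] //=; elim/last_ind: p' => [|p' z _] //=.
    rewrite rcons_path last_rcons => /andP[hy /andP[_ hz]].
    have vE (x : vertex (add_leaf v)) :
        @adj (add_leaf v) x (h None) -> x = h (Some v).
      by move: x; apply: (hW _) => -[x|]; rewrite adjh //= => /eqP ->.
    have hy' : @adj (add_leaf v) y (h None) by rewrite sym'.
    rewrite (vE y hy') (vE z hz) mem_rcons !inE eqxx.
    by rewrite !andbF.
  pose q := [seq odflt v (unlift ord_max x) | x <- p].
  have -> : p = map hS q.
    rewrite -map_comp -[LHS]map_id; apply/eq_in_map => x xp /=.
    rewrite -[LHS]unlift_maxK; case E: (unlift ord_max x) => [j|] //=.
    by move: newp; rewrite /h -E unlift_maxK xp.
  rewrite size_map /ucycle => /andP[cq uq]; apply: acyc; rewrite /ucycle.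
  rewrite (map_uniq uq) andbT.
  by rewrite -(mono_cycle adjS).
Qed.

End AddLeaf.

Local Open Scope quotient_scope.
Local Open Scope ring_scope.

(** * Isomorphism classes of trees of a given size *)

Definition tree_of (G : graph) (tG : is_tree G) : tree :=
  \pi_{eq_quot tree_iso} (exist _ G tG).

Lemma rep_tree (t : tree) : is_tree (rep t).
Proof. exact: valP. Qed.

Lemma rep_inj (s t : tree) : iso (rep s) (rep t) -> s = t.
Proof.
move=> st; rewrite -(reprK (s : {eq_quot tree_iso})) -(reprK (t : {eq_quot tree_iso})).
by apply/eqmodP.
Qed.

Lemma iso_tree_of (G : graph) (tG : is_tree G) : iso (rep (tree_of tG)) G.
Proof.
have /eqmodP := reprK (tree_of tG : {eq_quot tree_iso}).
by [].
Qed.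

Lemma tree_of_rep (s : tree) (tG : is_tree (rep s)) : tree_of tG = s.
Proof. exact/rep_inj/iso_tree_of. Qed.

Lemma iso_size (G H : graph) : iso G H -> tag G = tag H.
Proof.
move=> /asboolP[f /bij_eq_card]; by rewrite !card_ord.
Qed.

Lemma tree_size_of (G : graph) (tG : is_tree G) : tree_size (tree_of tG) = tag G.
Proof. exact/iso_size/iso_tree_of. Qed.

(** Listing the classes of size [n] without repetition makes laws and expectations at time [n]
    finite sums. *)
Definition trees (n : nat) : seq tree :=
  undup [seq \pi_{eq_quot tree_iso} t | t <- pmap insub
    [seq Tagged (fun n => {set 'I_n * 'I_n}) E | E <- enum {set 'I_n * 'I_n}]].

Lemma trees_uniq n : uniq (trees n).
Proof. exact: undup_uniq. Qed.

Lemma mem_trees n s : (s \in trees n) = (tree_size s == n).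
Proof.
apply/idP/eqP => [|sn].
  rewrite mem_undup => /mapP[[G tG]]; rewrite mem_pmap_sub => /mapP[E _ /= GE] ->.
  by rewrite -[LHS]/(tree_size (tree_of tG)) tree_size_of GE.
rewrite mem_undup -(tree_of_rep (rep_tree s)); apply: map_f.
rewrite mem_pmap_sub /= -sn /tree_size; case: (rep s) => k E.
by apply: map_f; rewrite mem_enum.
Qed.

Lemma iso_deg (G H : graph) (f : vertex G -> vertex H) : bijective f ->
  (forall x y, adj (f x) (f y) = adj x y) -> forall v, deg (f v) = deg v.
Proof.
move=> fbij fadj v; rewrite !degE (reindex f) /=; last exact: onW_bij.
by apply: eq_bigr => w _; rewrite fadj.
Qed.

Lemma big_deg_iso (T : Type) (idx : T) (op : Monoid.com_law idx) (g : nat -> T)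
    (G H : graph) : iso G H ->
  \big[op/idx]_(v : vertex G) g (deg v) = \big[op/idx]_(v : vertex H) g (deg v).
Proof.
move=> /asboolP[f fbij fadj]; rewrite [RHS](reindex f) /=; last exact: onW_bij.
by apply: eq_bigr => v _; rewrite (iso_deg fbij fadj).
Qed.

Section AttachProb.
Variable R : realType.
Implicit Types (s t : tree).

Lemma sum_deg_rep t : \sum_(v : vertex (rep t)) deg v = (tree_size t).-1.*2.
Proof. exact/sum_deg_tree/rep_tree. Qed.

(** Each vertex [v] yields exactly one class [s], so exchanging the sums leaves one term per [v];
    invariance of [F] makes the chosen representative irrelevant. *)
Lemma attach_sum (F : graph -> R) t :
  (forall G H, iso G H -> F G = F H) ->
  \sum_(s <- trees (tree_size t).+1) attach_prob R t s * F (rep s) =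
  (\sum_(v : vertex (rep t)) (deg v)%:R * F (add_leaf v)) / (2 * (tree_size t).-1%:R).
Proof.
move=> F_iso.
have -> : 2 * (tree_size t).-1%:R = \sum_(v : vertex (rep t)) (deg v)%:R :> R.
  by rewrite -natr_sum sum_deg_rep -mul2n natrM.
under eq_bigr => s _ do rewrite /attach_prob mulrAC mulr_suml.
rewrite -mulr_suml; congr (_ / _).
rewrite (exchange_big_dep xpredT) //=; apply: eq_bigr => v _.
have tv := add_leaf_tree v (rep_tree t).
rewrite big_mkcond (bigD1_seq (tree_of tv)) ?trees_uniq ?mem_trees ?tree_size_of //=.
rewrite iso_sym iso_tree_of (F_iso _ _ (iso_tree_of tv)) big1 ?addr0 // => s snv.
case: ifP => // vs; case/eqP: snv; apply: rep_inj.
by rewrite iso_sym (iso_trans (iso_tree_of tv) vs).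
Qed.

End AttachProb.

(** * Moments of power sums of degrees *)

Lemma deriv_prod (R : comNzRingType) (V : finType) (f : V -> {poly R}) :
  (\prod_v f v)^`() = \sum_v (f v)^`() * \prod_(u | u != v) f u.
Proof.
suff H (s : seq V) : uniq s ->
    (\prod_(v <- s) f v)^`() =
    \sum_(v <- s) (f v)^`() * \prod_(u <- s | u != v) f u.
  by rewrite H ?index_enum_uniq.
elim: s => [|x s IH] /=; first by rewrite !big_nil derivC.
move=> /andP[xs us]; rewrite !big_cons derivM IH // eqxx /=; congr (_ * _ + _).
  rewrite [RHS]big_seq_cond [LHS]big_seq; apply: eq_bigl => u.
  by rewrite andb_idr // => usm; apply: contraNneq xs => <-.
rewrite big_distrr /= [LHS]big_seq [RHS]big_seq; apply: eq_bigr => v vs.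
rewrite big_cons (_ : x != v); last by apply: contraNneq xs => ->.
by rewrite mulrCA.
Qed.

Section MomentPolynomial.
Variables (R : realFieldType) (a P : nat).

(** Exponential generating function of the sequence [k]^(a j), cut off at degree [P]; coefficients
    of degree at most [P] in a product are not affected by the cut. *)
Definition rise_poly (k : nat) : {poly R} :=
  \poly_(j < P.+1) ((rise k (a * j))%:R / j`!%:R).

(* Up to the factor [p`!], its coefficient of degree [p <= P] is the sum of
   [prod_v rise (d v) (a * m_v)] over the maps ['I_p -> V], where [m_v] counts
   the preimages of [v]; it bounds the [p]-th power of [sum_v rise (d v) a]. *)
Definition moment_poly (V : finType) (d : V -> nat) : {poly R} :=
  \prod_v rise_poly (d v).

Lemma rise_poly_ge0 k j : 0 <= (rise_poly k)`_j.
Proof. by rewrite coef_poly; case: ifP => // _; rewrite divr_ge0. Qed.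

Lemma coef_prod_ge0 (V : finType) (A : pred V) (f : V -> {poly R}) j :
  (forall v i, 0 <= (f v)`_i) -> 0 <= (\prod_(v | A v) f v)`_j.
Proof.
move=> f0; elim/big_rec: _ j => [|v p _ IH] j; first by rewrite coef1.
by rewrite coefM sumr_ge0 // => i _; rewrite mulr_ge0.
Qed.

Lemma moment_poly_ge0 (V : finType) (d : V -> nat) j : 0 <= (moment_poly d)`_j.
Proof. by apply: coef_prod_ge0 => v i; exact: rise_poly_ge0. Qed.

(** In degree [j] this is k [k+1]^(a j) = [k]^(a j) (k + a j); the operator X d/dX produces the
    factor [j]. *)
Lemma rise_poly_succ k :
  k%:R *: rise_poly k.+1 = k%:R *: rise_poly k + a%:R *: ('X * (rise_poly k)^`()).
Proof.
apply/polyP => j; rewrite !coefE.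
case: ltnP => jP; last first.
  by case: j jP => [//|j jP] /=; rewrite ltnNge jP /= mul0rn !mulr0 addr0.
rewrite !mulrA -natrM rise_succ natrM natrD mulrDr mulrDl [_ * k%:R]mulrC.
congr (_ + _); case: j jP => [|j] jP /=.
  by rewrite muln0 mulr0 mul0r mulr0.
by rewrite jP natrM -[X in _ = _ * X]mulr_natr; ring.
Qed.

(** The new leaf contributes the factor [rise_poly 1], and the derivatives of the single factors add
    up to that of the product by the Leibniz rule. *)
Lemma moment_poly_grow (V : finType) (d : V -> nat) :
  \sum_v (d v)%:R *: moment_poly (grow_deg d v) =
  rise_poly 1 * ((\sum_v d v)%:R *: moment_poly d
                 + a%:R *: ('X * (moment_poly d)^`())).
Proof.
have E v : (d v)%:R *: moment_poly (grow_deg d v) =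
    rise_poly 1 * ((d v)%:R *: moment_poly d + a%:R *: ('X *
      ((rise_poly (d v))^`() * \prod_(u | u != v) rise_poly (d u)))).
  rewrite /moment_poly big_option /= scalerAr; congr (_ * _).
  rewrite (bigD1 v) //= eqxx addn1 scalerAl rise_poly_succ.
  rewrite [in RHS](bigD1 v) //= mulrDl -scalerAl; congr (_ + _).
    congr (_ *: (_ * _)); apply: eq_bigr => u /negbTE ->; by rewrite addn0.
  rewrite -scalerAl -mulrA; congr (_ *: (_ * (_ * _))).
  by apply: eq_bigr => u /negbTE ->; rewrite addn0.
rewrite (eq_bigr _ (fun v _ => E v)) -big_distrr /= big_split /= -scaler_suml -natr_sum.
by rewrite /moment_poly deriv_prod -scaler_sumr -big_distrr.
Qed.

(** Only degrees [p - j] occur on the right, so the means of the coefficients obey a closed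
    triangular system of recursions. *)
Lemma moment_coef_grow (V : finType) (d : V -> nat) p :
  \sum_v (d v)%:R * (moment_poly (grow_deg d v))`_p =
  \sum_(j < p.+1) (rise_poly 1)`_j *
    (((\sum_v d v)%:R + (a * (p - j))%:R) * (moment_poly d)`_(p - j)).
Proof.
have /(congr1 (fun q : {poly R} => q`_p)) := moment_poly_grow d.
rewrite coef_sum (eq_bigr _ (fun v _ => coefZ _ _ _)).
move=> ->; rewrite coefM; apply: eq_bigr => j _; congr (_ * _).
rewrite coefD !coefZ coefXM coef_deriv mulrDl; congr (_ + _).
case: (p - j)%N => [|i] /=; first by rewrite muln0 mulr0 mul0r.
by rewrite natrM -[_`__ *+ _]mulr_natl mulrA.
Qed.

Lemma moment_coef0 (V : finType) (d : V -> nat) : (moment_poly d)`_0 = 1.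
Proof.
rewrite /moment_poly; elim/big_rec: _ => [|v p _ IH]; first by rewrite coef1.
by rewrite coefM big_ord1 subnn IH coef_poly /= muln0 rise0 divr1 mulr1.
Qed.

(** The right-hand side is a coefficient of the derivative, which the Leibniz rule splits over [v];
    termwise the bound is [d]^(a) [d]^(a j) <= [d]^(a (j+1)). *)
Lemma moment_coefS (V : finType) (d : V -> nat) p : (p < P)%N ->
  (\sum_v rise (d v) a)%:R * (moment_poly d)`_p <= p.+1%:R * (moment_poly d)`_p.+1.
Proof.
move=> pP; rewrite [p.+1%:R * _]mulr_natl -coef_deriv deriv_prod coef_sum.
rewrite natr_sum mulr_suml.
apply: ler_sum => v _; rewrite /moment_poly (bigD1 v) //= !coefM mulr_sumr.
apply: ler_sum => j _; rewrite mulrA; apply: ler_wpM2r.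
  by apply: coef_prod_ge0 => u i; exact: rise_poly_ge0.
have jP : (j < P)%N by apply: leq_trans pP; rewrite ltnS -ltnS.
rewrite coef_deriv !coef_poly (leqW jP) (jP : (j.+1 < P.+1)%N) mulrA -natrM.
have -> : (rise (d v) (a * j.+1))%:R / (j.+1)`!%:R *+ j.+1
    = (rise (d v) (a * j.+1))%:R / j`!%:R :> R.
  rewrite -mulr_natr factS natrM invfM -!mulrA; congr (_ * _).
  by rewrite mulrC mulfK ?pnatr_eq0.
apply: ler_wpM2r; first by rewrite invr_ge0.
by rewrite ler_nat mulnS leq_riseM.
Qed.

Lemma sum_rise_le_moment (V : finType) (d : V -> nat) p : (p <= P)%N ->
  (\sum_v rise (d v) a)%:R ^+ p <= p`!%:R * (moment_poly d)`_p.
Proof.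
elim: p => [|p IH] pP; first by rewrite moment_coef0 mulr1.
rewrite exprS factS mulnC natrM -mulrA.
apply: le_trans (ler_wpM2l _ (moment_coefS _ pP)) => //.
rewrite mulrCA; apply: ler_wpM2l => //.
by rewrite IH // ltnW.
Qed.

End MomentPolynomial.

(** * Growth of sequences under one-step recursions *)

Section Growth.
Variable R : rcfType.
Implicit Types (q N m : nat).

(** Bernoulli's inequality for (1 + 1/N)^(q/2), with [t] the square root of 1 + 1/N. *)
Lemma bernoulli_sqrt q N : (2 <= q)%N -> (0 < N)%N ->
  1 + q%:R / (2 * N%:R) <= (Num.sqrt N.+1%:R / Num.sqrt N%:R) ^+ q :> R.
Proof.
move=> q2 N0; set t : R := Num.sqrt _ / _; pose h : R := N%:R^-1.
have N0' : (0 : R) < N%:R by rewrite ltr0n.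
have h0 : 0 < h by rewrite invr_gt0.
have t0 : 0 <= t by rewrite divr_ge0 ?sqrtr_ge0.
have t2 : t ^+ 2 = 1 + h.
  by rewrite /t expr_div_n !sqr_sqrtr ?ler0n // -natr1 mulrDl divff ?gt_eqF // mul1r.
have -> : q%:R / (2 * N%:R) = q%:R * h / 2 :> R by rewrite invfM mulrA mulrAC.
have t1 : 1 <= t by rewrite -(@ler_pXn2r _ 2) ?nnegrE // expr1n t2 lerDl ltW.
(* As t^2 = 1 + h, the exponent goes up in steps of 2 from the cases 2 and 3; the case 3 is checked
   after squaring. *)
suff H : forall r, 1 + (r.*2 + 2)%:R * h / 2 <= t ^+ (r.*2 + 2) /\
    1 + (r.*2 + 3)%:R * h / 2 <= t ^+ (r.*2 + 3).
  have [r [->|->]] : exists r, q = (r.*2 + 2)%N \/ q = (r.*2 + 3)%N.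
  - exists (q - 2)./2; have := odd_double_half (q - 2).
    by case: (odd _) => /=; lia.
  - by case: (H r).
  - by case: (H r).
have step n : 1 + n%:R * h / 2 <= t ^+ n -> 1 + n.+2%:R * h / 2 <= t ^+ n.+2.
  move=> IH; rewrite -[n.+2]addn2 exprD t2.
  apply: le_trans (ler_wpM2r _ IH); last by lra.
  rewrite natrD; have : 0 <= n%:R * h * h by rewrite !mulr_ge0 // ltW.
  nra.
elim=> [|r [IH1 IH2]]; last by split; apply: step.
rewrite !add0n t2; split; first by lra.
rewrite -(@ler_pXn2r _ 2) ?nnegrE ?exprn_ge0 //; last by nra.
by rewrite -exprM mulnC exprM t2; nra.
Qed.

(** Telescoping bound that makes N^(-3/2) summable. With s and s' the two roots, the difference on
    the right is 1 / (s s' (s + s')), and s' <= 2 s bounds this denominator by 6 s^3. *)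
Lemma sqrt_step N : (0 < N)%N ->
  (Num.sqrt N%:R ^+ 3)^-1 <=
  6 * ((Num.sqrt N%:R)^-1 - (Num.sqrt N.+1%:R)^-1) :> R.
Proof.
move=> N0; set s : R := Num.sqrt N%:R; set s' : R := Num.sqrt _.
have N1 : (1 : R) <= N%:R by rewrite ler1n.
have s2 : s ^+ 2 = N%:R by rewrite sqr_sqrtr // ler0n.
have s2' : s' ^+ 2 = s ^+ 2 + 1 by rewrite s2 sqr_sqrtr ?ler0n // natr1.
have s0 : 0 < s by rewrite sqrtr_gt0; lra.
have s0' : 0 < s' by rewrite sqrtr_gt0 ltr0n.
have ss' : s' <= 2 * s.
  rewrite -(@ler_pXn2r _ 2) ?nnegrE ?mulr_ge0 // ?ltW // s2' exprMn s2; lra.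
have E : s^-1 - s'^-1 = (s * s' * (s + s'))^-1.
  have d1 : (s' - s) * (s + s') = 1 by rewrite [s + s']addrC -subr_sqr s2'; ring.
  have sD : s + s' != 0 by rewrite gt_eqF // addr_gt0.
  apply: (mulIf sD); rewrite invfM mulrVK ?unitfE // invfM.
  have -> : s^-1 - s'^-1 = (s' - s) * (s^-1 * s'^-1).
    by field; rewrite !gt_eqF.
  by rewrite mulrAC d1 mul1r.
rewrite E -[6]invrK -invfM lef_pV2 ?posrE; last 2 first.
- by rewrite exprn_gt0.
- by rewrite mulr_gt0 ?invr_gt0 // !mulr_gt0 // addr_gt0.
rewrite mulrC ler_pdivrMr //.
have h1 : s * s' <= s * (2 * s) by rewrite ler_pM2l.
have h2 : s + s' <= 3 * s by lra.
apply: le_trans (ler_pM _ _ h1 h2) _.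
- by rewrite mulr_ge0 // ltW.
- by rewrite addr_ge0 // ltW.
- by rewrite le_eqVlt; apply/orP; left; apply/eqP; ring.
Qed.

(** After division by N^(q/2) the main factor is harmless by [bernoulli_sqrt], and each step adds at
    most C N^(-3/2), a summable error. *)
Lemma sqrt_growth (x : nat -> R) q m (C : R) : (3 <= q)%N -> (0 < m)%N ->
  0 <= C -> (forall N, (m <= N)%N -> 0 <= x N) ->
  (forall N, (m <= N)%N -> x N.+1 <=
    (1 + q%:R / (2 * N%:R)) * x N + C * Num.sqrt N%:R ^+ (q - 3)) ->
  exists K, forall N, (m <= N)%N -> x N <= K * Num.sqrt N%:R ^+ q.
Proof.
move=> q3 m0 C0 x0 xS.
pose s N : R := Num.sqrt N%:R.
have s_gt0 N : (m <= N)%N -> 0 < s N.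
  by move=> mN; rewrite sqrtr_gt0 ltr0n (leq_trans m0).
(* The second term pays, by [sqrt_step], for all errors still to come, so [y] does not increase. *)
pose y N := x N / s N ^+ q + 6 * C / s N.
have y_anti N : (m <= N)%N -> y N.+1 <= y N.
  move=> mN; have s0 := s_gt0 N mN; have s0' := s_gt0 N.+1 (leqW mN).
  have N0 : (0 < N)%N := leq_trans m0 mN.
  have h1 : x N.+1 / s N.+1 ^+ q <= x N / s N ^+ q + C / s N ^+ 3.
    rewrite ler_pdivrMr ?exprn_gt0 //; apply: le_trans (xS N mN) _.
    rewrite [leRHS]mulrDl; apply: lerD.
      rewrite [leRHS]mulrAC -[leRHS]mulrA mulrC; apply: ler_wpM2l; first exact: x0.
      by rewrite -expr_div_n; apply: bernoulli_sqrt => //; exact: ltnW.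
    rewrite -mulrA; apply: ler_wpM2l => //.
    rewrite mulrC ler_pdivlMr ?exprn_gt0 // -exprD subnK //.
    apply: lerXn2r; rewrite ?nnegrE ?ltW //.
    by rewrite /s ltr_sqrt ?ltr_nat ?ltr0n.
  rewrite /y; have h2 := ler_wpM2l C0 (sqrt_step N0); move: h1 h2.
  by rewrite -/(s N) -/(s N.+1); lra.
exists (y m) => N mN.
have : y N <= y m.
  rewrite -(subnK mN); elim: (N - m)%N => // k IH.
  by apply: le_trans (y_anti _ _) IH; rewrite leq_addl.
have s0 := s_gt0 N mN.
move=> yN; rewrite -ler_pdivrMr ?exprn_gt0 //; apply: le_trans yN.
by rewrite lerDl divr_ge0 ?mulr_ge0 // ltW.
Qed.

(** Induction on [p]. The terms with j >= 1 are of the lower order N^(a (p - j) / 2), and a >= 3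
    makes them an admissible error in [sqrt_growth]. *)
Lemma moment_growth (x : nat -> nat -> R) (f : nat -> R) a m :
  (3 <= a)%N -> (0 < m)%N -> f 0 = 1 -> (forall j, 0 <= f j) ->
  (forall p N, (m <= N)%N -> 0 <= x p N) ->
  (forall N, (m <= N)%N -> x 0 N = 1) ->
  (forall p N, (m <= N)%N -> x p N.+1 =
    \sum_(j < p.+1) f j * ((1 + (a * (p - j))%:R / (2 * N%:R)) * x (p - j)%N N)) ->
  forall p, exists K, forall N, (m <= N)%N -> x p N <= K * Num.sqrt N%:R ^+ (a * p).
Proof.
move=> a3 m0 f0 f_ge0 x_ge0 x0 xS p.
(* One constant serves all exponents up to [p], since the recursion for [p + 1] involves all of
   them. *)
suff [K HK] : exists K, forall i N, (i <= p)%N -> (m <= N)%N ->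
  x i N <= K * Num.sqrt N%:R ^+ (a * i) by exists K => N; exact: HK.
elim: p => [|p [K IH]].
  by exists 1 => i N; rewrite leqn0 => /eqP -> /x0 ->; rewrite muln0 expr0 mulr1.
have s_ge1 N : (m <= N)%N -> 1 <= Num.sqrt N%:R :> R.
  move=> mN; rewrite -[leLHS]sqrtr1; apply: ler_wsqrtr.
  by rewrite ler1n (leq_trans m0).
have K0 : 0 <= K by have := IH 0%N m (leq0n _) (leqnn _); rewrite x0 // muln0 mulr1; lra.
pose C := \sum_(j < p.+1) f j.+1 * ((1 + (a * (p - j))%:R) * K).
have C0 : 0 <= C by apply: sumr_ge0 => j _; rewrite !mulr_ge0 // addr_ge0.
have [|N mN||K' HK'] := @sqrt_growth (x p.+1) (a * p.+1) m C _ m0 C0.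
- by rewrite mulnS (leq_trans a3) // leq_addr.
- exact: x_ge0.
- move=> N mN; rewrite xS // big_ord_recl /= f0 mul1r subn0 lerD2l.
  rewrite /C mulr_suml; apply: ler_sum => j _.
  rewrite /bump /= add1n subSS -!mulrA; apply: ler_wpM2l => //.
  have N1 : (1 : R) <= N%:R by rewrite ler1n (leq_trans m0).
  apply: ler_pM.
  + by rewrite addr_ge0 // divr_ge0 // mulr_ge0.
  + exact: x_ge0.
  + rewrite lerD2l ler_pdivrMr; last by lra.
    by rewrite ler_peMr //; lra.
  + apply: le_trans (IH _ N (leq_subr _ _) mN) _; apply: ler_wpM2l => //.
    apply: ler_weXn2l; first exact: s_ge1.
    rewrite mulnS -addnBAC //; apply: leq_trans (leq_addl _ _).
    by rewrite leq_mul2l leq_subr orbT.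
exists (Num.max K K') => i N; rewrite leq_eqVlt => /predU1P[->|ip] mN.
  apply: le_trans (HK' N mN) _; apply: ler_wpM2r; first by rewrite exprn_ge0 ?sqrtr_ge0.
  by rewrite le_max lexx orbT.
apply: le_trans (IH i N ip mN) _; apply: ler_wpM2r; first by rewrite exprn_ge0 ?sqrtr_ge0.
by rewrite le_max lexx.
Qed.

End Growth.

(** * Expectations along the process *)

Definition iso_invariant (T : Type) (F : graph -> T) :=
  forall G H, iso G H -> F G = F H.

(** The process reduced to its one-dimensional laws and the transition kernel, which is all that the
    moment estimates see. *)
Definition lpam_law (R : realType) (S : tree) (q : nat -> tree -> R) :=
  [/\ forall n s, 0 <= q n s,
      forall s, q (tree_size S) s = (s == S)%:R &
      forall n s, (tree_size S <= n)%N ->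
        q n.+1 s = \sum_(t <- trees n) q n t * attach_prob R t s].

Definition expect (R : realType) (q : nat -> tree -> R) (n : nat) (F : graph -> R) : R :=
  \sum_(s <- trees n) q n s * F (rep s).

Definition grow_mean (R : realType) (F : graph -> R) (G : graph) : R :=
  (\sum_(v : vertex G) (deg v)%:R * F (add_leaf v)) / (2 * (tag G).-1%:R).

Section Expect.
Variables (R : realType).
Implicit Types (q : nat -> tree -> R) (F : graph -> R).

Lemma eq_expect q n F F' :
  (forall G, is_tree G -> tag G = n -> F G = F' G) -> expect q n F = expect q n F'.
Proof.
move=> FF'; rewrite /expect [LHS]big_seq [RHS]big_seq; apply: eq_bigr => s.
rewrite mem_trees => /eqP sn; congr (_ * _); apply: FF' => //; exact: rep_tree.
Qed.

Lemma le_expect q n F F' : (forall s, 0 <= q n s) ->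
  (forall G, is_tree G -> tag G = n -> F G <= F' G) -> expect q n F <= expect q n F'.
Proof.
move=> q0 FF'; rewrite /expect [leLHS]big_seq [leRHS]big_seq; apply: ler_sum => s.
rewrite mem_trees => /eqP sn; apply: ler_wpM2l => //; apply: FF' => //; exact: rep_tree.
Qed.

Lemma expectZ q n c F : expect q n (fun G => c * F G) = c * expect q n F.
Proof. by rewrite /expect mulr_sumr; apply: eq_bigr => s _; rewrite mulrCA. Qed.

Lemma expectD q n F F' :
  expect q n (fun G => F G + F' G) = expect q n F + expect q n F'.
Proof. by rewrite /expect -big_split; apply: eq_bigr => s _; rewrite mulrDr. Qed.

Lemma expect_sum q n (J : Type) (r : seq J) (A : pred J) (F : J -> graph -> R) :
  expect q n (fun G => \sum_(j <- r | A j) F j G) =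
  \sum_(j <- r | A j) expect q n (F j).
Proof.
rewrite /expect exchange_big /=; apply: eq_bigr => s _; by rewrite mulr_sumr.
Qed.

Variables (S : tree) (q : nat -> tree -> R).
Hypotheses (S2 : (2 <= tree_size S)%N) (qS : lpam_law S q).

Lemma expect_step n F : iso_invariant F -> (tree_size S <= n)%N ->
  expect q n.+1 F = expect q n (grow_mean F).
Proof.
move=> F_iso Sn; have [_ _ step] := qS; rewrite /expect.
under eq_bigr => s _ do rewrite step // mulr_suml.
rewrite exchange_big /= [LHS]big_seq [RHS]big_seq; apply: eq_bigr => t.
rewrite mem_trees => /eqP tn; under eq_bigr => s _ do rewrite -mulrA.
rewrite -mulr_sumr; congr (_ * _); rewrite -tn; exact: attach_sum.
Qed.

Lemma expect1 n : (tree_size S <= n)%N -> expect q n (fun=> 1) = 1.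
Proof.
move=> Sn; rewrite -(subnK Sn); elim: (n - _)%N => [|k IH].
  have [_ q0 _] := qS; rewrite add0n /expect (bigD1_seq S) ?trees_uniq ?mem_trees //=.
  by rewrite q0 eqxx mulr1 big1 ?addr0 // => s /negbTE sS; rewrite q0 sS mul0r.
rewrite addSn expect_step ?leq_addl // -[RHS]IH; apply: eq_expect => G tG Gn.
rewrite /grow_mean; under eq_bigr => v _ do rewrite mulr1.
rewrite -natr_sum sum_deg_tree // -mul2n natrM divff //.
by rewrite -natrM pnatr_eq0 -lt0n muln_gt0 /= Gn -subn1 subn_gt0 (leq_trans S2) ?leq_addl.
Qed.

Lemma expect_ge0 n F : (forall G, 0 <= F G) -> 0 <= expect q n F.
Proof. by move=> F0; apply: sumr_ge0 => s _; rewrite mulr_ge0 //; case: qS. Qed.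

Definition sum_rise (a : nat) (G : graph) : R := (\sum_(v : vertex G) rise (deg v) a)%:R.

(** Time is shifted to N = n - 1, half the total degree, so that the recursion for the means has the
    form required by [moment_growth]; cutting [rise_poly] at degree [p] suffices. *)
Lemma sum_rise_moments a p : (3 <= a)%N -> exists K : R, forall N,
  ((tree_size S).-1 <= N)%N ->
  expect q N.+1 (fun G => sum_rise a G ^+ p) <= K * Num.sqrt N%:R ^+ (a * p).
Proof.
move=> a3; pose M (k : nat) (G : graph) : R := (moment_poly R a p (@deg G))`_k.
have S_gt0 : (0 < (tree_size S).-1)%N by rewrite -subn1 subn_gt0.
have q0 : forall n s, 0 <= q n s by case: qS.
have M_iso k : iso_invariant (M k).
  move=> G H GH; rewrite /M /moment_poly.
  by rewrite (big_deg_iso _ (fun j => rise_poly R a p j) GH).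
have SN N : ((tree_size S).-1 <= N)%N -> (tree_size S <= N.+1)%N.
  by move=> ?; rewrite -(prednK (ltnW S2)) ltnS.
have [|||||K HK] := @moment_growth R (fun k N => expect q N.+1 (M k))
    (fun j => (rise_poly R a p 1)`_j) a (tree_size S).-1 a3 S_gt0 _ _ _ _ _ p.
- by rewrite coef_poly /= muln0 rise0 divr1.
- by move=> j; exact: rise_poly_ge0.
- by move=> k N _; apply: expect_ge0 => G; exact: moment_poly_ge0.
- move=> N mN; rewrite -[RHS](expect1 (SN N mN)); apply: eq_expect => G _ _.
  exact: moment_coef0.
- move=> k N mN; rewrite expect_step ?SN //.
  have N0 : (0 < N)%N := leq_trans S_gt0 mN.
  transitivity (expect q N.+1 (fun G => \sum_(j < k.+1) (rise_poly R a p 1)`_j *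
      (1 + (a * (k - j))%:R / (2 * N%:R)) * M (k - j)%N G)).
    apply: eq_expect => G tG GN; rewrite /grow_mean.
    have -> : \sum_(v : vertex G) (deg v)%:R * M k (add_leaf v) =
        \sum_(v : vertex G) (deg v)%:R * (moment_poly R a p (grow_deg (@deg G) v))`_k.
      apply: eq_bigr => v _; rewrite /M.
      suff -> : moment_poly R a p (@deg (add_leaf v)) =
          moment_poly R a p (grow_deg (@deg G) v) by [].
      rewrite /moment_poly (reindex (@leaf_vertex (tag G))) /=; last first.
        exact/onW_bij/leaf_vertex_bij.
      by apply: eq_bigr => x _; rewrite add_leaf_deg.
    rewrite moment_coef_grow sum_deg_tree // GN /= -mul2n natrM mulr_suml.
    apply: eq_bigr => j _; rewrite -!mulrA; congr (_ * _).
    have N0' : N%:R != 0 :> R by rewrite pnatr_eq0 -lt0n.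
    rewrite /M; set c := (_ * (k - j))%:R; by field.
  rewrite expect_sum; apply: eq_bigr => j _; by rewrite expectZ mulrA.
exists (p`!%:R * K) => N mN; rewrite -mulrA.
apply: le_trans (ler_wpM2l _ (HK N mN)) => //.
rewrite -expectZ; apply: le_expect => // G _ _.
exact: sum_rise_le_moment.
Qed.

End Expect.

(** * Moments of the weighted embedding counts *)

Lemma prod_le_sum_pow (R : realDomainType) (I : finType) (J : {set I}) (y : I -> R) :
  (forall i, 0 <= y i) -> \prod_(i in J) y i <= 1 + \sum_(i in J) y i ^+ #|J|.
Proof.
move=> y0; have [->|/set0Pn[i0 i0J]] := eqVneq J finset.set0.
  by rewrite !big_set0 addr0.
(* Every factor is at most the largest one; the summand 1 on the right is for the empty set. *)
have [k kJ kmax] := @arg_maxP _ _ _ i0 (mem J) y i0J.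
apply: (@le_trans _ _ (y k ^+ #|J|)).
  rewrite -prodr_const; apply: ler_prod => i iJ; rewrite y0 /=; exact: kmax.
rewrite (bigD1 k) //= addrCA lerDl addr_ge0 // sumr_ge0 // => i _.
exact: exprn_ge0.
Qed.

Section Embedding.
Variables (R : realType) (I : finType) (e : rel I).
Hypothesis e_sym : symmetric e.

Definition emb_count (J : {set I}) (w : I -> nat) (G : graph) : R :=
  (emb_sum e (@adj G) (@deg G) J w)%:R.

Lemma iso_emb_count J w : iso_invariant (emb_count J w).
Proof.
move=> G H /asboolP[f fbij fadj]; rewrite /emb_count.
by rewrite (emb_sum_iso e J w fbij fadj (iso_deg fbij fadj)).
Qed.

Lemma grow_emb_count J w G : is_tree G -> (1 < tag G)%N ->
  grow_mean (emb_count J w) G =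
  (1 + (\sum_(i in J) w i)%:R / (2 * (tag G).-1%:R)) * emb_count J w G +
  (2 * (tag G).-1%:R)^-1 * \sum_(u in J) (branch e (@adj G) (@deg G) J w u)%:R.
Proof.
move=> tG G1; rewrite /grow_mean.
have -> : \sum_(v : vertex G) (deg v)%:R * emb_count J w (add_leaf v) =
    (\sum_(v : vertex G) deg v *
      emb_sum e (grow_adj (@adj G) v) (grow_deg (@deg G) v) J w)%:R.
  rewrite natr_sum; apply: eq_bigr => v _; rewrite natrM; congr (_ * _%:R).
  apply: emb_sum_iso (leaf_vertex_bij _) _ _ => [x y|x].
    exact: add_leaf_adj.
  exact: add_leaf_deg.
rewrite emb_sum_grow // sum_deg_tree // natrD natrM natrD -mul2n natrM.
rewrite mulrDl; congr (_ + _); last by rewrite mulrC natr_sum.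
rewrite mulrAC mulrDl divff //.
by rewrite -natrM pnatr_eq0 -lt0n muln_gt0 /= -subn1 subn_gt0.
Qed.

Lemma emb_count_le_prod J w G : emb_count J w G <= \prod_(i in J) sum_rise R (w i) G.
Proof. by rewrite -natr_prod ler_nat emb_sum_le. Qed.

(** Each power sum is scaled by its order N^(w/2); [prod_le_sum_pow], in place of Hölder's
    inequality, then turns the mixed moment into moments of single power sums. *)
Lemma emb_count_moment (S : tree) (q : nat -> tree -> R) J w :
  (2 <= tree_size S)%N -> lpam_law S q -> (forall i, (3 <= w i)%N) ->
  exists K : R, forall N, ((tree_size S).-1 <= N)%N ->
    expect q N.+1 (fun G => emb_count J w G ^+ 2) <= K * N%:R ^+ (\sum_(i in J) w i).
Proof.
move=> S2 qS w3.
have q0 : forall n s, 0 <= q n s by case: qS.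
have S_gt0 : (0 < (tree_size S).-1)%N by rewrite -subn1 subn_gt0.
(* Each factor is squared by the second moment, then raised to the power #|J| by
   [prod_le_sum_pow]. *)
pose p := (2 * #|J|)%N.
have /choice[K HK] : forall i, exists Ki : R, forall N, ((tree_size S).-1 <= N)%N ->
    expect q N.+1 (fun G => sum_rise R (w i) G ^+ p) <= Ki * Num.sqrt N%:R ^+ (w i * p).
  by move=> i; exact: sum_rise_moments.
exists (1 + \sum_(i in J) K i) => N mN.
have N0 : (0 < N)%N := leq_trans S_gt0 mN.
set s : R := Num.sqrt N%:R in HK *.
have s0 : 0 < s by rewrite sqrtr_gt0 ltr0n.
have s2 : s ^+ 2 = N%:R by rewrite sqr_sqrtr.
have -> : N%:R ^+ (\sum_(i in J) w i) = \prod_(i in J) (s ^+ w i) ^+ 2 :> R.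
  by rewrite -s2 exprAC expr_sum -prodrXl.
apply: (@le_trans _ _ (expect q N.+1 (fun G => \prod_(i in J) (s ^+ w i) ^+ 2 *
    (1 + \sum_(i in J) (s ^+ (w i * p))^-1 * sum_rise R (w i) G ^+ p)))).
  apply: le_expect => // G _ _.
  have X0 i : 0 <= sum_rise R (w i) G by exact: ler0n.
  have sw i : 0 < s ^+ w i by exact: exprn_gt0.
  have := @prod_le_sum_pow R I J (fun i => (sum_rise R (w i) G / s ^+ w i) ^+ 2).
  move/(_ (fun i => sqr_ge0 _)) => H.
  have {}H : \prod_(i in J) (sum_rise R (w i) G / s ^+ w i) ^+ 2 <=
      1 + \sum_(i in J) (s ^+ (w i * p))^-1 * sum_rise R (w i) G ^+ p.
    apply: le_trans H _; rewrite lerD2l; apply: ler_sum => i _.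
    by rewrite -exprM expr_div_n -exprM mulrC.
  apply: le_trans (ler_wpM2l _ H); last by apply: prodr_ge0 => i _; exact: sqr_ge0.
  rewrite -big_split /=; under eq_bigr => i _ do rewrite -exprMn mulrC divfK ?gt_eqF //.
  rewrite prodrXl lerXn2r ?nnegrE ?emb_count_le_prod ?ler0n //.
  by apply: prodr_ge0 => i _.
rewrite expectZ expectD expect_sum (expect1 S2 qS); last first.
  by rewrite -(prednK (ltnW S2)) ltnS.
rewrite mulrC; apply: ler_wpM2r; first by apply: prodr_ge0 => i _; exact: sqr_ge0.
rewrite lerD2l; apply: ler_sum => i _; rewrite expectZ.
by rewrite mulrC ler_pdivrMr ?exprn_gt0 //; exact: HK.
Qed.

End Embedding.

(** * Separating two laws by a difference of means *)

Lemma cauchy_schwarz_abs (R : realFieldType) (X : eqType) (r : seq X) (f g : X -> R) :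
  (\sum_(x <- r) f x * g x) ^+ 2 <=
  (\sum_(x <- r) `|f x|) * \sum_(x <- r) `|f x| * g x ^+ 2.
Proof.
set L := \sum_(x <- r) `|f x|; set B := \sum_(x <- r) `|f x| * _.
set A := \sum_(x <- r) `|f x| * `|g x|.
have L0 : 0 <= L by exact: sumr_ge0.
have A0 : 0 <= A by apply: sumr_ge0 => x _; exact: mulr_ge0.
have fgA : `|\sum_(x <- r) f x * g x| <= A.
  by apply: le_trans (ler_norm_sum _ _ _) _; apply: ler_sum => x _; rewrite normrM.
rewrite -real_normK ?num_real //; apply: (@le_trans _ _ (A ^+ 2)).
  by rewrite lerXn2r ?nnegrE.
(* Expanding the nonnegative sum of |f| (L |g| - A)^2 gives the claim times L, so L = 0 is treated
   apart. *)
have H : 0 <= L * (L * B - A ^+ 2).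
  have -> : L * (L * B - A ^+ 2) = \sum_(x <- r) `|f x| * (L * `|g x| - A) ^+ 2.
    transitivity (\sum_(x <- r) (L ^+ 2 * (`|f x| * g x ^+ 2)
        - 2 * L * A * (`|f x| * `|g x|) + A ^+ 2 * `|f x|)).
      rewrite big_split sumrB /= -!mulr_sumr -/L -/A -/B; ring.
    apply: eq_bigr => x _; rewrite -[g x ^+ 2]real_normK ?num_real //; ring.
  by apply: sumr_ge0 => x _; rewrite mulr_ge0 // sqr_ge0.
have [L_gt0|L_le0] := ltP 0 L.
  by rewrite -subr_ge0 -(pmulr_rge0 _ L_gt0).
have L00 : L = 0 by apply/eqP; rewrite eq_le L_le0.
suff -> : A = 0 by rewrite L00 mul0r expr0n.
move: L00; rewrite /L => /eqP; rewrite psumr_eq0 // => /allP f0.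
by rewrite /A big1_seq // => x /andP[_ xr]; rewrite (eqP (f0 x xr)) mul0r.
Qed.

Section Gap.
Variables (R : realType) (S1 S2 : tree) (q1 q2 : nat -> tree -> R) (m : nat).
Hypotheses (S1_ge2 : (2 <= tree_size S1)%N) (S2_ge2 : (2 <= tree_size S2)%N).
Hypotheses (S1m : (tree_size S1 <= m)%N) (S2m : (tree_size S2 <= m)%N).
Hypotheses (law1 : lpam_law S1 q1) (law2 : lpam_law S2 q2).

Definition gap (n : nat) (F : graph -> R) : R := expect q1 n F - expect q2 n F.

Lemma eq_gap n F F' :
  (forall G, is_tree G -> tag G = n -> F G = F' G) -> gap n F = gap n F'.
Proof. by move=> FF'; rewrite /gap !(eq_expect _ FF'). Qed.

Lemma gapZ n c F : gap n (fun G => c * F G) = c * gap n F.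
Proof. by rewrite /gap !expectZ mulrBr. Qed.

Lemma gapD n F F' : gap n (fun G => F G + F' G) = gap n F + gap n F'.
Proof. by rewrite /gap !expectD; ring. Qed.

Lemma gap_sum n (J : Type) (r : seq J) (A : pred J) (F : J -> graph -> R) :
  gap n (fun G => \sum_(j <- r | A j) F j G) = \sum_(j <- r | A j) gap n (F j).
Proof. by rewrite /gap !expect_sum -sumrB. Qed.

Lemma gap_step n F : iso_invariant F -> (m <= n)%N -> gap n.+1 F = gap n (grow_mean F).
Proof.
move=> F_iso mn.
by rewrite /gap (expect_step law1) ?(expect_step law2) // (leq_trans _ mn).
Qed.

Variables (I : finType) (e : rel I).
Hypothesis e_sym : symmetric e.
Let emb := emb_count R e.

(** Case analysis on the neighbours of [u] in [J]: none, a loop or several, exactly one. On trees of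
    size [n] the branch is zero or a constant multiple of a count for [J] without [u], whose gap
    vanishes by hypothesis. *)
Lemma gap_branch n (J : {set I}) w u : (forall i, (3 <= w i)%N) -> u \in J ->
  (forall (J' : {set I}) w', (forall i, (3 <= w' i)%N) -> (#|J'| < #|J|)%N ->
     gap n (emb J' w') = 0) ->
  gap n (fun G => (branch e (@adj G) (@deg G) J w u)%:R) = 0.
Proof.
move=> w3 uJ small.
have Ju : (#|J :\ u| < #|J|)%N by rewrite [ltnRHS](cardsD1 u) uJ.
have gap0 : gap n (fun=> 0) = 0.
  by have := gapZ n 0 (fun=> 0); rewrite !mul0r.
have [/existsP[t /andP[tJ eut]]|] := boolP [exists t, (t \in J) && e u t]; last first.
  rewrite negb_exists => /forallP nt.
  have nu j : j \in J -> ~~ e u j by move=> jJ; have := nt j; rewrite jJ.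
  rewrite (@eq_gap _ _ (fun G => (w u)`!%:R *
      ((n.-1.*2 + \sum_(i in J :\ u) w i)%:R * emb (J :\ u) w G))).
    by rewrite !gapZ small // !mulr0.
  move=> G tG Gn; rewrite branch_isolated // sum_deg_tree // Gn.
  by rewrite !natrM.
have [many|] := boolP [exists t', [&& t' \in J, e u t' & (t == t') ==> (t == u)]].
  have /existsP[t' /and3P[t'J eut' tt']] := many.
  rewrite (@eq_gap _ _ (fun=> 0)) // => G _ _.
  by rewrite (branch_many _ _ _ tJ t'J).
rewrite negb_exists => /forallP nt.
have tu : t != u by have := nt t; rewrite tJ eut eqxx.
have ut j : j \in J -> e u j -> j = t.
  move=> jJ euj; apply/eqP; have := nt j.
  by rewrite jJ euj /= negb_imply eq_sym => /andP[].
rewrite (@eq_gap _ _ (fun G => (w u)`!%:R * emb (J :\ u) (fun i => w i + (i == t))%N G)).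
  by rewrite gapZ small ?mulr0 // => i; rewrite (leq_trans (w3 i)) // leq_addr.
by move=> G _ _; rewrite (branch_leaf _ _ _ tJ tu eut ut) natrM.
Qed.

Lemma gap_emb_step n (J : {set I}) w : (m <= n)%N -> (forall i, (3 <= w i)%N) ->
  (forall (J' : {set I}) w', (forall i, (3 <= w' i)%N) -> (#|J'| < #|J|)%N ->
     gap n (emb J' w') = 0) ->
  gap n.+1 (emb J w) =
  (1 + (\sum_(i in J) w i)%:R / (2 * n.-1%:R)) * gap n (emb J w).
Proof.
move=> mn w3 small; rewrite gap_step //; last exact: iso_emb_count.
have n1 : (1 < n)%N by apply: leq_trans mn; exact: leq_trans S1m.
pose W := (\sum_(i in J) w i)%:R / (2 * n.-1%:R) : R.
rewrite (@eq_gap _ _ (fun G => (1 + W) * emb J w G + (2 * n.-1%:R)^-1 *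
    \sum_(u in J) (branch e (@adj G) (@deg G) J w u)%:R)).
  by rewrite gapD !gapZ gap_sum big1 ?mulr0 ?addr0 // => u uJ; exact: gap_branch.
by move=> G tG Gn; rewrite (grow_emb_count _ e_sym) ?Gn.
Qed.

(** The gap is multiplied by 1 + W/(2N), and (1 + W/(2N))^2 >= 1 + W/N, which is the ratio of
    [N+1]^(W) to [N]^(W). So the squared gap over [N]^(W) never decreases, and [N]^(W) >= N^W. *)
Lemma gap_lower_bound (J : {set I}) w : (forall i, (3 <= w i)%N) ->
  gap m (emb J w) != 0 ->
  (forall (J' : {set I}) w', (forall i, (3 <= w' i)%N) -> (#|J'| < #|J|)%N ->
     gap m (emb J' w') = 0) ->
  exists2 c : R, 0 < c & forall N, (m.-1 <= N)%N ->
    c * N%:R ^+ (\sum_(i in J) w i) <= gap N.+1 (emb J w) ^+ 2.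
Proof.
move=> w3 gap_neq0 small; set W := (\sum_(i in J) w i)%N.
have m1 : (0 < m.-1)%N by rewrite -subn1 subn_gt0 (leq_trans S1_ge2).
have SN N : (m.-1 <= N)%N -> (m <= N.+1)%N.
  by rewrite -[in X in _ -> X](@prednK m) //; case: (m) m1.
(* Vanishing for fewer vertices persists in time: a zero gap is only multiplied, because the still
   smaller counts have zero gap as well. *)
have small' N : (m.-1 <= N)%N -> forall (J' : {set I}) w',
    (forall i, (3 <= w' i)%N) -> (#|J'| < #|J|)%N -> gap N.+1 (emb J' w') = 0.
  move=> mN; rewrite -(subnK mN); elim: (N - _)%N => [|k IH] J' w' w3' J'J.
    by rewrite add0n prednK ?small //; case: (m) m1.
  rewrite addSn gap_emb_step ?IH ?mulr0 //.
    by rewrite SN // leq_addl.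
  by move=> J'' w'' w3'' J''J'; apply: IH => //; exact: ltn_trans J''J' J'J.
exists (gap m (emb J w) ^+ 2 / (rise m.-1 W)%:R) => [|N mN].
  by rewrite divr_gt0 ?exprn_even_gt0 // ltr0n rise_gt0.
have R0 k : (0 < k)%N -> 0 < (rise k W)%:R :> R by move=> k0; rewrite ltr0n rise_gt0.
apply: (@le_trans _ _ (gap m (emb J w) ^+ 2 / (rise m.-1 W)%:R * (rise N W)%:R)).
  rewrite ler_wpM2l ?divr_ge0 ?sqr_ge0 //.
  by rewrite -natrX ler_nat leq_expn_rise.
rewrite -(subnK mN); elim: (N - _)%N => [|k IH].
  rewrite add0n divfK ?gt_eqF ?R0 // prednK //; by case: (m) m1.
rewrite addSn; set M := (k + m.-1)%N in IH *.
have M0 : (0 < M)%N by rewrite (leq_trans m1) // leq_addl.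
have M0' : (0 : R) < M%:R by rewrite ltr0n.
rewrite gap_emb_step //; last 2 first.
- by rewrite SN // leq_addl.
- by apply: small'; rewrite leq_addl.
rewrite -/W exprMn /=.
have -> : (rise M.+1 W)%:R = (1 + W%:R / M%:R) * (rise M W)%:R :> R.
  apply: (mulfI (lt0r_neq0 M0')); rewrite -natrM rise_succ natrM natrD.
  by field; rewrite gt_eqF.
rewrite mulrCA; apply: ler_pM => //.
- by rewrite mulr_ge0 ?divr_ge0 ?sqr_ge0.
have -> : W%:R / (2 * M%:R) = W%:R / M%:R / 2 :> R by rewrite invfM mulrA mulrAC.
have : 0 <= W%:R / M%:R :> R by rewrite divr_ge0.
by set h := _ / _ => h0; have := sqr_ge0 h; nra.
Qed.

(** Cauchy-Schwarz with respect to |q1 - q2|, which is at most q1 + q2. *)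
Lemma gap_sqr_le n F : gap n F ^+ 2 <=
  (\sum_(s <- trees n) `|q1 n s - q2 n s|) *
  (expect q1 n (fun G => F G ^+ 2) + expect q2 n (fun G => F G ^+ 2)).
Proof.
have -> : gap n F = \sum_(s <- trees n) (q1 n s - q2 n s) * F (rep s).
  by rewrite /gap /expect -sumrB; apply: eq_bigr => s _; rewrite mulrBl.
apply: le_trans (cauchy_schwarz_abs _ _ _) _.
apply: ler_wpM2l; first exact: sumr_ge0.
rewrite /expect -big_split /=; apply: ler_sum => s _; rewrite -mulrDl.
apply: ler_wpM2r; first exact: sqr_ge0.
apply: le_trans (ler_normB _ _) _.
by have [q10 _ _] := law1; have [q20 _ _] := law2; rewrite !ger0_norm.
Qed.

(** For [J] minimal the squared gap is at least of order N^W and the second moments at most, so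
    their ratio bounds the l1 distance from below. *)
Lemma gap_separates (J : {set I}) w : (forall i, (3 <= w i)%N) ->
  gap m (emb J w) != 0 ->
  exists2 c : R, 0 < c & forall n, (m <= n)%N ->
    c <= \sum_(s <- trees n) `|q1 n s - q2 n s|.
Proof.
(* Descent to a vertex set of least size among those with a nonzero gap for some weights. *)
have [k] := ubnP #|J|; elim: k J w => // k IH J w Jk w3 gap_neq0.
have [[J' [w' [w3' J'J gap']]]|none] := pselect (exists (J' : {set I}) w',
    [/\ forall i, (3 <= w' i)%N, (#|J'| < #|J|)%N & gap m (emb J' w') != 0]).
  by apply: (IH J' w') => //; apply: leq_trans J'J _; rewrite -ltnS.
have small (J' : {set I}) w' : (forall i, (3 <= w' i)%N) -> (#|J'| < #|J|)%N ->
    gap m (emb J' w') = 0.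
  move=> w3' J'J; apply/eqP/negPn/negP => gap'; apply: none; by exists J', w'.
have [c c0 Hc] := gap_lower_bound w3 gap_neq0 small.
have [K1 HK1] := emb_count_moment e J S1_ge2 law1 w3.
have [K2 HK2] := emb_count_moment e J S2_ge2 law2 w3.
pose K := `|K1| + `|K2| + 1.
have K0 : 0 < K by rewrite ltr_wpDl // addr_ge0.
exists (c / K); first by rewrite divr_gt0.
case=> [|N] mN; first by move: (leq_trans S1_ge2 (leq_trans S1m mN)).
have mN' : (m.-1 <= N)%N by rewrite -subn1 leq_subLR add1n.
have m1 : (0 < m.-1)%N by rewrite -subn1 subn_gt0 (leq_trans S1_ge2).
have N0 : (0 : R) < N%:R by rewrite ltr0n (leq_trans m1).
set L := \sum_(s <- _) _.
have L0 : 0 <= L by exact: sumr_ge0.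
have NW : 0 < N%:R ^+ (\sum_(i in J) w i) :> R by exact: exprn_gt0.
rewrite ler_pdivrMr // -(ler_pM2r NW) -mulrA.
apply: le_trans (Hc N mN') _; apply: le_trans (gap_sqr_le _ _) _.
apply: ler_wpM2l => //.
have pm (S : tree) : (tree_size S <= m)%N -> ((tree_size S).-1 <= N)%N.
  by move=> Sm; apply: leq_trans mN'; rewrite -!subn1 leq_sub2r.
apply: le_trans (lerD (HK1 N (pm _ S1m)) (HK2 N (pm _ S2m))) _.
rewrite -mulrDl; apply: ler_wpM2r; first exact: ltW.
have := ler_norm K1; have := ler_norm K2; rewrite /K; lra.
Qed.

End Gap.

(** * Distinct seeds differ in some mean *)

Lemma deg_gt0 (G : graph) (v : vertex G) : is_tree G -> (1 < tag G)%N -> (0 < deg v)%N.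
Proof.
move=> /is_treeP[_ _ _ con _] G1.
have [z zv] : exists z : vertex G, z \notin [set v]%SET.
  apply/existsP; rewrite -negb_forall; apply/negP => /forallP all_v.
  have : (#|vertex G| <= #|[set v]%SET|)%N.
    by apply: subset_leq_card; apply/fintype.subsetP => x _; exact: all_v.
  by rewrite cards1 card_ord leqNgt G1.
have [u [w [/set1P -> _ vw]]] := connect_exit (con v z) (set11 v) zv.
by rewrite /deg; apply/card_gt0P; exists w.
Qed.

(** A constant degree k would give k n = 2 (n - 1), which fails for k = 0, k = 1 and k >= 2 as soon
    as n >= 3. *)
Lemma deg_nonconstant (G : graph) : is_tree G -> (3 <= tag G)%N ->
  exists u v : vertex G, deg u != deg v.
Proof.
move=> tG G3; have /is_treeP[G0 _ _ _ _] := tG.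
pose u : vertex G := Ordinal G0.
apply: contrapT => same.
have const (v : vertex G) : deg v = deg u.
  by apply/eqP/negPn/negP => vu; apply: same; exists v, u.
have := sum_deg_tree tG; rewrite (eq_bigr _ (fun v _ => const v)).
rewrite sum_nat_const card_ord -mul2n; case: (deg u) => [|[|k]]; nia.
Qed.

(** The sum of squared degrees is an isomorphism invariant, and attaching at [t] raises it by (deg t
    + 1)^2 - (deg t)^2 + 1 = 2 deg t + 2. *)
Lemma add_leaf_iso_deg (G : graph) (u v : vertex G) :
  iso (add_leaf u) (add_leaf v) -> deg u = deg v.
Proof.
have E (t : vertex G) : (\sum_(x : vertex (add_leaf t)) deg x ^ 2 =
    \sum_(x : vertex G) deg x ^ 2 + deg t * 2 + 2)%N.
  rewrite (reindex (@leaf_vertex (tag G))) /=; last exact/onW_bij/leaf_vertex_bij.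
  under eq_bigr => x _ do rewrite add_leaf_deg.
  rewrite big_option /= (bigD1 t) //= [in RHS](bigD1 t) //= eqxx.
  under eq_bigr => x /negbTE xt do rewrite xt addn0.
  by move: (\sum_(x | _) _)%N => s; rewrite -!mulnn; nia.
by move=> uv; have := E u; rewrite (big_deg_iso _ (fun k => k ^ 2)%N uv) E; lia.
Qed.

(** An injection between vertex sets of equal size is a bijection, and two trees of the same size
    have the same number of edges, so no edge of [H] is missed. *)
Lemma tree_embedding_iso (G H : graph) (f : {ffun vertex G -> option (vertex H)}) :
  is_tree G -> is_tree H -> tag G = tag H ->
  embeds (@adj G) (@adj H) [set: vertex G]%SET f -> iso G H.
Proof.
move=> tG tH GH /asboolP[f1 f2 f3].
(* The default [cast_ord] is never taken; it only makes [g] total. *)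
pose g x : vertex H := odflt (cast_ord GH x) (f x).
have fg x : f x = Some (g x).
  by have := f1 x; rewrite /g finset.in_setT; case: (f x).
have g_inj : injective g.
  by move=> x y gxy; apply: f2; rewrite ?finset.in_setT // !fg gxy.
have g_bij : bijective g by apply: inj_card_bij => //; rewrite !card_ord GH.
have g_adj x y : adj x y -> adj (g x) (g y) by apply: f3; exact: fg.
have sumE : (\sum_x \sum_y adj (g x) (g y) = \sum_(x : vertex G) \sum_y adj x y)%N.
  transitivity (\sum_(v : vertex H) deg v)%N.
    rewrite [RHS](reindex g) /=; last exact: onW_bij.
    by apply: eq_bigr => x _; rewrite degE [RHS](reindex g) //=; exact: onW_bij.
  by rewrite sum_deg_tree // -GH -sum_deg_tree //; apply: eq_bigr => x _; rewrite degE.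
apply/asboolP; exists g => // x y.
have le_adj a b : (adj a b <= adj (g a) (g b) ?= iff (adj a b == adj (g a) (g b)))%N.
  split; last by case: (adj a b); case: (adj (g a) (g b)).
  by have := @g_adj a b; case: (adj a b) => [->|_].
have [_] := leqif_sum (P := xpredT) (fun (p : vertex G * vertex G) _ => le_adj p.1 p.2).
rewrite -(pair_bigA _ (fun a b => nat_of_bool (adj a b))).
rewrite -(pair_bigA _ (fun a b => nat_of_bool (adj (g a) (g b)))) /= sumE eqxx.
by move=> /esym/forallP/(_ (x, y))/eqP ->.
Qed.

Section Seeds.
Variable R : realType.

Lemma attach_prob_ge0 (t s : tree) : 0 <= attach_prob R t s.
Proof. by rewrite divr_ge0 ?sumr_ge0. Qed.

(** Of two vertices of different degree at most one can produce [s], and the other one is chosen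
    with positive probability. *)
Lemma attach_prob_lt1 (t s : tree) : (3 <= tree_size t)%N -> attach_prob R t s < 1.
Proof.
move=> t3; have tt := rep_tree t; have t1 : (1 < tag (rep t))%N by exact: leq_trans t3.
have [u [v uv]] := deg_nonconstant tt t3.
have [x xs] : exists x : vertex (rep t), ~~ iso (add_leaf x) (rep s).
  have [us|us] := boolP (iso (add_leaf u) (rep s)); last by exists u.
  exists v; apply: contra uv => vs; apply/eqP/add_leaf_iso_deg.
  by apply: iso_trans us _; rewrite iso_sym.
have dx : 0 < (deg x)%:R :> R by rewrite ltr0n deg_gt0.
rewrite /attach_prob.
have Sx := bigD1 (op := +%R) x (P := xpredT) (F := fun y => (deg y)%:R : R) isT.
have rest0 : 0 <= \sum_(y | y != x) (deg y)%:R :> R by exact: sumr_ge0.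
have pos : 0 < \sum_(y : vertex (rep t)) (deg y)%:R :> R by rewrite Sx ltr_pwDl.
rewrite ltr_pdivrMr // mul1r Sx; apply: ltr_pwDl => //.
rewrite [leRHS](bigID (fun y => iso (add_leaf y) (rep s))) /=.
rewrite (eq_bigl (fun y => (y != x) && iso (add_leaf y) (rep s))).
  by rewrite lerDl sumr_ge0.
by move=> y; rewrite andb_idl // => ys; apply: contraNneq xs => <-.
Qed.

(** [q n s] is an average of attachment probabilities, all below 1, with weights of total mass 1. *)
Lemma law_lt1 (S : tree) (q : nat -> tree -> R) n s : (3 <= tree_size S)%N ->
  lpam_law S q -> (tree_size S < n)%N -> q n s < 1.
Proof.
move=> S3 qS; case: n => // n; rewrite ltnS => Sn.
have [q_ge0 _ step] := qS; rewrite step //.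
have S2 := ltnW S3.
have := expect1 S2 qS Sn; rewrite /expect; under eq_bigr => t _ do rewrite mulr1.
move=> sum1; rewrite -[ltRHS]sum1 -subr_gt0 -sumrB lt_def.
have ge0 t : t \in trees n -> 0 <= q n t - q n t * attach_prob R t s.
  rewrite mem_trees => /eqP tn; rewrite -[X in X - _]mulr1 -mulrBr mulr_ge0 //.
  by rewrite subr_ge0 ltW // attach_prob_lt1 // tn (leq_trans S3).
apply/andP; split; last by rewrite big_seq sumr_ge0.
apply/eqP => sum0.
have : \sum_(t <- trees n) q n t = 0; last by rewrite sum1 => /eqP; rewrite oner_eq0.
rewrite big_seq big1 // => t tn.
have /eqP := sum0; rewrite big_seq psumr_eq0 // => /allP /(_ t tn).
rewrite tn /= -[X in X - _]mulr1 -mulrBr mulf_eq0 => /orP[/eqP //|].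
rewrite subr_eq0 eq_sym lt_eqF // attach_prob_lt1 //.
by move: tn; rewrite mem_trees => /eqP ->; exact: leq_trans Sn.
Qed.

Lemma gap_seed_neq0 (S1 S2 : tree) (q1 q2 : nat -> tree -> R) :
  (3 <= tree_size S1)%N -> (tree_size S1 <= tree_size S2)%N -> S1 <> S2 ->
  lpam_law S1 q1 -> lpam_law S2 q2 ->
  gap q1 q2 (tree_size S2)
    (emb_count R (@adj (rep S2)) [set: vertex (rep S2)]%SET (fun=> 3)) != 0.
Proof.
move=> S3 S12 S_neq law1 law2; set m := tree_size S2; set F := emb_count _ _ _ _.
have q_lt1 : q1 m S2 < 1.
  move: S12; rewrite leq_eqVlt => /predU1P[E|S12]; last exact: law_lt1 law1 S12.
  have [_ q10 _] := law1; rewrite /m -E q10.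
  by case: eqVneq => [S21|]; rewrite ?ltr01 //; case: S_neq.
have F0 s : tree_size s = m -> s != S2 -> F (rep s) = 0.
  move=> sm sS2; apply/eqP; rewrite pnatr_eq0 sum_nat_eq0; apply/forallP => f.
  apply/implyP => ef; case/eqP: sS2; apply/esym/rep_inj.
  by apply: tree_embedding_iso ef => //; exact: rep_tree.
have F1 : 0 < F (rep S2).
  rewrite ltr0n lt0n sum_nat_eq0 negb_forall; apply/existsP.
  exists [ffun x => Some x]; rewrite negb_imply -lt0n; apply/andP; split.
    apply/asboolP; split => [i|i j _ _|i j x y].
    - by rewrite ffunE finset.in_setT.
    - by rewrite !ffunE => -[].
    - by rewrite !ffunE => -[<-] [<-].
  apply: prodn_cond_gt0 => i _; rewrite ffunE /= rise_gt0 // deg_gt0 //.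
    exact: rep_tree.
  by apply: leq_trans S12; exact: ltnW.
have E (q : nat -> tree -> R) : expect q m F = q m S2 * F (rep S2).
  rewrite /expect (bigD1_seq S2) ?trees_uniq ?mem_trees ?eqxx //=.
  rewrite big_seq_cond big1 ?addr0 // => s /andP[]; rewrite mem_trees => /eqP sm sS2.
  by rewrite F0 ?mulr0.
have [_ q20 _] := law2.
rewrite /gap !E q20 eqxx -mulrBl mulf_neq0 //; last by rewrite gt_eqF.
by rewrite subr_eq0 lt_eqF.
Qed.

End Seeds.

(** * Laws and total variation *)

Local Open Scope classical_set_scope.
Local Open Scope ring_scope.

Section Law.
Variables (R : realType) (d : measure_display) (Omega : measurableType d).
Variable P : probability Omega R.
Implicit Types (A B : set Omega) (X : {RV P >-> tree}).

Let pr A : R := fine (P A).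

Let prU A B : measurable A -> measurable B -> A `&` B = set0 ->
  pr (A `|` B) = pr A + pr B.
Proof.
by move=> mA mB AB; rewrite /pr measureU // fineD // fin_num_measure.
Qed.

Let pr_ge0 A : 0 <= pr A.
Proof. by rewrite fine_ge0. Qed.

Let pr_null A B : measurable A -> measurable B -> pr B = 0 -> pr (A `&` B) = 0.
Proof.
move=> mA mB B0; apply/eqP; rewrite eq_le pr_ge0 andbT -B0.
rewrite fine_le ?fin_num_measure //; first exact: measurableI.
by apply: le_measure; rewrite ?inE //; exact: measurableI.
Qed.

Lemma measurable_tree_event X (B : set tree) : measurable (X @^-1` B).
Proof. exact: measurable_funPTI. Qed.

Let meas_eq X t : measurable [set w | X w = t].
Proof. exact: (measurable_tree_event X [set t]). Qed.

Let pr_mem X A (r : seq tree) : measurable A -> uniq r ->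
  pr (A `&` [set w | X w \in r]) = \sum_(t <- r) pr (A `&` [set w | X w = t]).
Proof.
move=> mA; elim: r => [_|t r IH /= /andP[tr ur]].
  rewrite big_nil (_ : _ `&` _ = set0) /pr ?measure0 //.
  by apply/seteqP; split => w // [].
rewrite big_cons -IH // -prU; last 3 first.
- by apply: measurableI => //; exact: meas_eq.
- by apply: measurableI => //; exact: (measurable_tree_event X [set s | s \in r]).
- apply/seteqP; split => w // -[[_ /= wt] [_ /= wr]].
  by rewrite wt (negbTE tr) in wr.
congr pr; rewrite -setIUr; congr (_ `&` _); apply/seteqP; split => w /=.
- by rewrite inE => /predU1P[->|]; [left|right].
- by rewrite inE => -[->|->]; rewrite ?eqxx ?orbT.
Qed.

Let pr_split X A n : measurable A -> pr [set w | X w \notin trees n] = 0 ->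
  pr A = \sum_(t <- trees n) pr (A `&` [set w | X w = t]).
Proof.
move=> mA X0; rewrite -pr_mem ?trees_uniq //.
have mX (Q : set tree) : measurable (X @^-1` Q) by exact: measurable_tree_event.
transitivity (pr (A `&` [set w | X w \in trees n]) +
              pr (A `&` [set w | X w \notin trees n])).
  rewrite -prU; last 3 first.
  - by apply: measurableI => //; exact: (mX [set s | s \in trees n]).
  - by apply: measurableI => //; exact: (mX [set s | s \notin trees n]).
  - by apply/seteqP; split => w // -[[_ /= wt] [_ /= /negP]].
  rewrite -setIUr [X in _ `&` X](_ : _ = setT) ?setIT //.
  by apply/seteqP; split => w //= _; case: (X w \in _); [left|right].
by rewrite [X in _ + X]pr_null ?addr0 //; exact: (mX [set s | s \notin trees n]).
Qed.

Lemma sum_attach_prob (t : tree) : (2 <= tree_size t)%N ->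
  \sum_(s <- trees (tree_size t).+1) attach_prob R t s = 1.
Proof.
move=> t2; have := @attach_sum R (fun=> 1) t (fun _ _ _ => erefl).
under eq_bigr do rewrite mulr1; move=> ->.
under eq_bigr do rewrite mulr1.
rewrite -natr_sum sum_deg_rep -mul2n natrM divff //.
by rewrite -natrM pnatr_eq0 -lt0n muln_gt0 -subn1 subn_gt0.
Qed.

Variables (S : tree) (T : nat -> {RV P >-> tree}).
Hypothesis S2 : (2 <= tree_size S)%N.
Hypothesis lpam : is_lpam S T.

Definition pmf (n : nat) (s : tree) : R := pr [set w | T n w = s].

Let hist k n (h : nat -> tree) :=
  [set w | forall i, (k <= i <= n)%N -> T i w = h i].

Let meas_hist k n h : measurable (hist k n h).
Proof.
have -> : hist k n h = \bigcap_i [set w | (k <= i <= n)%N -> T i w = h i].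
  by apply/seteqP; split => [w hw i _|w hw i]; [exact: hw|apply: hw].
apply: bigcapT_measurable => i; case: (boolP (k <= i <= n)%N) => ki.
  rewrite (_ : [set w | _] = [set w | T i w = h i]); first exact: meas_eq.
  by apply/seteqP; split => w /=; [exact|].
by rewrite (_ : [set w | _] = setT) //; apply/seteqP; split.
Qed.

Let n0 := tree_size S.

Let pr_seed : pr [set w | T n0 w != S] = 0.
Proof.
have [TS _] := lpam; rewrite /pr (@measure_negligible _ _ _ P) //.
  exact: (measurable_tree_event (T n0) [set s | s != S]).
by apply: negligibleS TS => w /eqP.
Qed.

(** [is_lpam] conditions on the whole past from time [n0]. Summing over the tree at time [k]
    shortens the window by one step, and the attachment factor, which depends only on [h n], comes
    out of the sum. *)
Let pr_markov n k h s : (n0 <= k <= n)%N ->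
  (forall i, (n0 <= i <= n)%N -> pr [set w | T i w \notin trees i] = 0) ->
  pr (hist k n h `&` [set w | T n.+1 w = s]) =
  pr (hist k n h) * attach_prob R (h n) s.
Proof.
move=> kn size0; have [_ step] := lpam.
case/andP: kn => n0k; rewrite -(subnK n0k); move: (k - n0)%N => {k n0k} k.
elim: k h => [|k IH] h kn.
  have := step n h s kn; rewrite /= -/(hist n0 n h) => H.
  rewrite /pr add0n H fineM // fin_num_measure //.
rewrite addSn in kn *; set k' := (k + n0)%N in IH kn *.
have k'n : (n0 <= k' <= n)%N by rewrite leq_addl ltnW.
pose h' t i := if i == k' then t else h i.
have E t : hist k'.+1 n h `&` [set w | T k' w = t] = hist k' n (h' t).
  apply/seteqP; split => [w [/= hw wt] i /andP[ki iN]|w hw].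
    rewrite /h'; case: eqVneq => [->//|ik].
    by apply: hw; rewrite iN andbT ltn_neqAle eq_sym ik.
  split => [i /andP[ki iN]|] /=.
    by rewrite hw ?iN ?(ltnW ki) // /h' gtn_eqF.
  by rewrite hw ?leqnn ?(andP k'n).2 // /h' eqxx.
rewrite (pr_split (X := T k') (n := k')); last 2 first.
- by apply: measurableI => //; exact: meas_eq.
- exact: size0.
rewrite [in RHS](pr_split (X := T k') (n := k')) //; last exact: size0.
rewrite mulr_suml; apply: eq_bigr => t _.
by rewrite setIAC E IH ?(andP k'n).2 // /h' gtn_eqF.
Qed.

Let pr_next n s : (n0 <= n)%N ->
  (forall i, (n0 <= i <= n)%N -> pr [set w | T i w \notin trees i] = 0) ->
  pmf n.+1 s = \sum_(t <- trees n) pmf n t * attach_prob R t s.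
Proof.
move=> n0n size0; rewrite /pmf (pr_split (X := T n) (n := n)); last 2 first.
- exact: meas_eq.
- by apply: size0; rewrite n0n leqnn.
apply: eq_bigr => t _; rewrite setIC.
have -> : [set w | T n w = t] = hist n n (fun=> t).
  apply/seteqP; split => [w /= wt i|w hw]; last by apply: hw; rewrite leqnn.
  by rewrite -eqn_leq => /eqP <-.
by rewrite pr_markov // n0n leqnn.
Qed.

(** Induction on time: given the sizes up to [m], [pr_next] applies, and the masses of the trees of
    size m + 1 add up to 1. *)
Let pr_size n : (n0 <= n)%N ->
  forall i, (n0 <= i <= n)%N -> pr [set w | T i w \notin trees i] = 0.
Proof.
move=> n0n; rewrite -(subnK n0n); move: (n - n0)%N => {n0n} n.
elim: n => [|n IH] i.
  rewrite add0n -eqn_leq => /eqP <-.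
  have mS : measurable [set w | T n0 w != S].
    exact: (measurable_tree_event (T n0) [set s | s != S]).
  rewrite -(pr_null _ mS pr_seed (A := [set w | T n0 w \notin trees n0])); last first.
    exact: (measurable_tree_event (T n0) [set s | s \notin trees n0]).
  congr pr; apply/seteqP; split => w /= => [wn|[]//].
  by split => //; apply: contraNneq wn => ->; rewrite mem_trees.
rewrite addSn => /andP[n0i]; rewrite leq_eqVlt => /predU1P[->|]; last first.
  by rewrite ltnS => iN; apply: IH; rewrite n0i.
set m := (n + n0)%N in IH *.
have n0m : (n0 <= m)%N by rewrite leq_addl.
have mT (Q : set tree) : measurable (T m.+1 @^-1` Q) by exact: measurable_tree_event.
have one : pr [set w | T m.+1 w \in trees m.+1] = 1.
  rewrite -[X in pr X]setTI pr_mem ?trees_uniq //.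
  under eq_bigr => s _ do rewrite setTI -/(pmf _ _) pr_next //.
  rewrite exchange_big /=.
  transitivity (\sum_(t <- trees m) pr (setT `&` [set w | T m w = t])).
    rewrite [LHS]big_seq [RHS]big_seq; apply: eq_bigr => t.
    rewrite mem_trees => /eqP tm; rewrite -mulr_sumr -tm sum_attach_prob.
      by rewrite mulr1 setTI tm.
    by rewrite tm (leq_trans S2).
  rewrite -pr_split //; first by rewrite /pr probability_setT.
  by apply: IH; rewrite n0m leqnn.
have -> : [set w | T m.+1 w \notin trees m.+1] = ~` [set w | T m.+1 w \in trees m.+1].
  by apply/seteqP; split => w /= /negP.
have mS := mT [set s | s \in trees m.+1].
have := @prU _ _ mS (measurableC mS) (setICr _).
by rewrite setUv {1}/pr probability_setT [pr (_ @^-1` _)]one /=; lra.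
Qed.

Lemma pmf_ge0 n s : 0 <= pmf n s.
Proof. exact: pr_ge0. Qed.

Lemma pmf_seed s : pmf (tree_size S) s = (s == S)%:R.
Proof.
rewrite -/n0 /pmf.
have mS : measurable [set w | T n0 w != S].
  exact: (measurable_tree_event (T n0) [set s | s != S]).
case: eqVneq => [->|sS].
  have H := @prU _ _ (meas_eq (T n0) S) (measurableC (meas_eq (T n0) S)) (setICr _).
  move: H; rewrite setUv {1}/pr probability_setT.
  have -> : ~` [set w | T n0 w = S] = [set w | T n0 w != S].
    by apply/seteqP; split => w /= /eqP.
  by rewrite pr_seed addr0 /= => <-.
transitivity (0 : R); last by [].
rewrite -(pr_null (meas_eq (T n0) s) mS pr_seed); congr pr.
by apply/seteqP; split => w /= => [->|[]//].
Qed.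

Lemma pmf_step n s : (tree_size S <= n)%N ->
  pmf n.+1 s = \sum_(t <- trees n) pmf n t * attach_prob R t s.
Proof. by move=> n0n; apply: pr_next => //; exact: pr_size. Qed.

Lemma distribution_pmf n (A : set tree) : (tree_size S <= n)%N ->
  fine (distribution P (T n) A) = \sum_(t <- trees n | t \in A) pmf n t.
Proof.
move=> n0n; have mA : measurable (T n @^-1` A) by exact: measurable_tree_event.
rewrite /distribution /pushforward -/(pr _) (pr_split (X := T n) (n := n)) //; last first.
  by apply: (pr_size n0n); rewrite n0n leqnn.
rewrite [RHS]big_mkcond; apply: eq_bigr => t _; case: ifPn => [|/negP] tA.
  congr pr; apply/seteqP; split => w /= => [[]//|wt]; split => //.
  by rewrite wt; rewrite inE in tA.
rewrite (_ : _ `&` _ = set0) /pr ?measure0 //.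
apply/seteqP; split => w //= -[Aw wt]; apply: tA.
by rewrite inE -wt.
Qed.

End Law.

(** * Total variation as a pseudometric *)

Section TotalVariation.
Variables (R : realType) (d : measure_display) (X : measurableType d).
Implicit Types mu nu rho : probability X R.

Let tv_set mu nu := [set `|fine (mu A) - fine (nu A)| | A in (measurable : set (set X))].

Let tv_set0 mu nu : tv_set mu nu !=set0.
Proof. by exists `|fine (mu set0) - fine (nu set0)|; exists set0. Qed.

Let fine_prob mu A : measurable A -> 0 <= fine (mu A) <= 1.
Proof.
move=> mA; rewrite fine_ge0 //= -lee_fin fineK ?fin_num_measure //.
exact: probability_le1.
Qed.

Lemma tv_dist_ge mu nu A : measurable A -> `|fine (mu A) - fine (nu A)| <= tv_dist mu nu.
Proof.
move=> mA; apply: ub_le_sup; last by exists A.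
exists 1 => _ [B mB <-]; have := fine_prob mu mB; have := fine_prob nu mB.
by rewrite ler_norml; lra.
Qed.

Lemma tv_dist_le mu nu b :
  (forall A, measurable A -> `|fine (mu A) - fine (nu A)| <= b) -> tv_dist mu nu <= b.
Proof. by move=> H; apply: ge_sup (tv_set0 mu nu) _ => _ [A mA <-]; exact: H. Qed.

Lemma tv_dist_ge0 mu nu : 0 <= tv_dist mu nu.
Proof. exact: le_trans (normr_ge0 _) (tv_dist_ge mu nu measurable0). Qed.

Lemma tv_dist_self mu : tv_dist mu mu = 0.
Proof.
apply/eqP; rewrite eq_le tv_dist_ge0 andbT.
by apply: tv_dist_le => A _; rewrite subrr normr0.
Qed.

Lemma tv_dist_sym mu nu : tv_dist mu nu = tv_dist nu mu.
Proof.
rewrite /tv_dist; congr sup; apply/seteqP.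
by split => _ [A mA <-]; exists A => //; rewrite distrC.
Qed.

Lemma tv_dist_triangle mu nu rho : tv_dist mu rho <= tv_dist mu nu + tv_dist nu rho.
Proof.
apply: tv_dist_le => A mA.
by apply: le_trans (ler_distD (fine (nu A)) _ _) _; rewrite lerD // tv_dist_ge.
Qed.

End TotalVariation.

Lemma lpam_law_pmf (R : realType) (d : measure_display) (Omega : measurableType d)
    (P : probability Omega R) (S : tree) (T : nat -> {RV P >-> tree}) :
  (2 <= tree_size S)%N -> is_lpam S T -> lpam_law S (pmf T).
Proof.
move=> S2 lpam; split => [n s|s|n s Sn].
- exact: pmf_ge0.
- exact: pmf_seed lpam s.
- exact: (pmf_step S2 lpam).
Qed.

(** * Total variation between two processes *)

Section TwoProcesses.
Variables (R : realType) (d1 d2 : measure_display).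
Variables (Omega1 : measurableType d1) (Omega2 : measurableType d2).
Variables (P1 : probability Omega1 R) (P2 : probability Omega2 R) (S1 S2 : tree).
Variables (T1 : nat -> {RV P1 >-> tree}) (T2 : nat -> {RV P2 >-> tree}).
Hypotheses (S1_ge2 : (2 <= tree_size S1)%N) (S2_ge2 : (2 <= tree_size S2)%N).
Hypotheses (lpam1 : is_lpam S1 T1) (lpam2 : is_lpam S2 T2).

Let delta n s : R := pmf T1 n s - pmf T2 n s.

Let diffE n (A : set tree) : (maxn (tree_size S1) (tree_size S2) <= n)%N ->
  fine (distribution P1 (T1 n) A) - fine (distribution P2 (T2 n) A) =
  \sum_(s <- trees n | s \in A) delta n s.
Proof.
rewrite geq_max => /andP[S1n S2n].
by rewrite (distribution_pmf S1_ge2) // (distribution_pmf S2_ge2) // -sumrB.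
Qed.

Let part_le n (A : pred tree) : (maxn (tree_size S1) (tree_size S2) <= n)%N ->
  `|\sum_(s <- trees n | A s) delta n s| <= tv_seq T1 T2 n.
Proof.
move=> mn; apply: le_trans (tv_dist_ge _ _ (A := [set s | A s]) _); last by [].
rewrite diffE // le_eqVlt; apply/orP; left; apply/eqP; congr `|_|.
by apply: eq_bigl => s; apply/idP/idP; rewrite inE.
Qed.

(** A sum weighted by values in [0,1] lies between the sum of the negative differences and that of
    the positive ones; each of these compares the two probabilities of one event. *)
Let weighted_le n (K : tree -> R) : (maxn (tree_size S1) (tree_size S2) <= n)%N ->
  (forall s, s \in trees n -> 0 <= K s <= 1) ->
  `|\sum_(s <- trees n) delta n s * K s| <= tv_seq T1 T2 n.
Proof.
move=> mn K01; rewrite ler_norml; apply/andP; split.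
  apply: le_trans (_ : \sum_(s <- trees n | delta n s < 0) delta n s <= _).
    by rewrite lerNl; apply: le_trans (ler_norm _) _; rewrite normrN part_le.
  rewrite [leLHS]big_mkcond [leLHS]big_seq [leRHS]big_seq; apply: ler_sum => s sn.
  have /andP[K0 K1] := K01 s sn; case: ltP => h; last exact: mulr_ge0.
  by rewrite -[leLHS]mulr1 ler_wnM2l // ltW.
apply: le_trans (_ : \sum_(s <- trees n | 0 <= delta n s) delta n s <= _); last first.
  by apply: le_trans (ler_norm _) _; rewrite part_le.
rewrite [leRHS]big_mkcond [leLHS]big_seq [leRHS]big_seq; apply: ler_sum => s sn.
have /andP[K0 K1] := K01 s sn; case: (leP 0 (delta n s)) => h; first exact: ler_piMr.
by rewrite mulr_le0_ge0 // ltW.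
Qed.

(** One step of the kernel turns an event at time n + 1 into a weight with values in [0,1] at time
    [n]. *)
Lemma tv_seq_nonincreasing n : (maxn (tree_size S1) (tree_size S2) <= n)%N ->
  tv_seq T1 T2 n.+1 <= tv_seq T1 T2 n.
Proof.
move=> mn; have := mn; rewrite geq_max => /andP[S1n S2n].
apply: tv_dist_le => A _; rewrite diffE ?leqW //.
have -> : \sum_(s <- trees n.+1 | s \in A) delta n.+1 s =
    \sum_(t <- trees n) delta n t *
      \sum_(s <- trees n.+1 | s \in A) attach_prob R t s.
  under eq_bigr => s _ do
    rewrite /delta (pmf_step S1_ge2) // (pmf_step S2_ge2) // -sumrB.
  rewrite exchange_big /=; apply: eq_bigr => t _; rewrite mulr_sumr.
  by apply: eq_bigr => s _; rewrite mulrBl.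
apply: weighted_le => // t; rewrite mem_trees => /eqP tn.
rewrite sumr_ge0 => [|s _]; last exact: attach_prob_ge0.
rewrite -(@sum_attach_prob R t); last by rewrite tn (leq_trans S1_ge2).
rewrite tn [leRHS](bigID (fun s => s \in A)) /= lerDl sumr_ge0 // => s _.
exact: attach_prob_ge0.
Qed.

Lemma tv_seq_cvg : cvgn (tv_seq T1 T2).
Proof.
set m := maxn (tree_size S1) (tree_size S2).
(* Monotonicity only starts at time [m], so the sequence is shifted. *)
suff /cvg_ex[l] : cvgn [sequence tv_seq T1 T2 (n + m)%N]_n.
  by rewrite cvg_shiftn => /cvgP.
apply: nonincreasing_is_cvgn.
  apply/nonincreasing_seqP => n /=; rewrite addSn.
  by apply: tv_seq_nonincreasing; rewrite leq_addl.
by exists 0 => _ [n _ <-]; exact: tv_dist_ge0.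
Qed.

(** Splitting by the sign of the difference gives two events, hence the factor 2. *)
Lemma l1_le_tv_seq n : (maxn (tree_size S1) (tree_size S2) <= n)%N ->
  \sum_(s <- trees n) `|pmf T1 n s - pmf T2 n s| <= 2 * tv_seq T1 T2 n.
Proof.
move=> mn; rewrite (bigID (fun s => 0 <= delta n s)) /= mulr2n mulrDl mul1r.
apply: lerD.
  rewrite (eq_bigr (delta n)) => [|s s0]; last by rewrite ger0_norm.
  by apply: le_trans (ler_norm _) _; rewrite part_le.
rewrite (eq_bigr (fun s => - delta n s)) => [|s]; last first.
  by rewrite -ltNge => s0; rewrite ltr0_norm.
by rewrite sumrN; apply: le_trans (ler_norm _) _; rewrite normrN part_le.
Qed.

End TwoProcesses.

(** The starting count is that of copies of the larger seed with all exponents 3; the descent to a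
    minimal count is left to [gap_separates]. *)
Lemma tv_seq_separates (R : realType) (d1 d2 : measure_display)
    (Omega1 : measurableType d1) (Omega2 : measurableType d2)
    (P1 : probability Omega1 R) (P2 : probability Omega2 R) (S1 S2 : tree)
    (T1 : nat -> {RV P1 >-> tree}) (T2 : nat -> {RV P2 >-> tree}) :
  (3 <= tree_size S1)%N -> (tree_size S1 <= tree_size S2)%N -> S1 <> S2 ->
  is_lpam S1 T1 -> is_lpam S2 T2 ->
  exists2 c : R, 0 < c & forall n, (tree_size S2 <= n)%N -> c <= tv_seq T1 T2 n.
Proof.
move=> S1_ge3 S12 S_neq lpam1 lpam2.
have S1_ge2 := ltnW S1_ge3; have S2_ge2 := leq_trans S1_ge2 S12.
have law1 := lpam_law_pmf S1_ge2 lpam1; have law2 := lpam_law_pmf S2_ge2 lpam2.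
have /is_treeP[_ _ sym _ _] := rep_tree S2.
have gap0 := gap_seed_neq0 S1_ge3 S12 S_neq law1 law2.
have [c c0 cP] := gap_separates S1_ge2 S2_ge2 S12 (leqnn _) law1 law2 sym
  (fun=> leqnn 3) gap0.
exists (c / 2) => [|n S2n]; first by rewrite divr_gt0.
rewrite ler_pdivrMr // mulrC; apply: le_trans (cP n S2n) _.
apply: (l1_le_tv_seq S1_ge2 S2_ge2 lpam1 lpam2).
by rewrite geq_max S2n (leq_trans S12).
Qed.

Theorem theorem1 (R : realType)
    (disp : tree -> measure_display)
    (Omega : forall S : tree, measurableType (disp S))
    (P : forall S : tree, probability (Omega S) R)
    (T : forall S : tree, nat -> {RV (P S) >-> tree})
    (T_lpam : forall S : tree, (2 <= tree_size S)%N -> is_lpam S (T S)) :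
  let tv (S1 S2 : tree) : nat -> R := tv_seq (T S1) (T S2) in
  let d (S1 S2 : tree) : R := lim (tv S1 S2 n @[n --> \oo]) in
  (forall S1 S2 : tree, (2 <= tree_size S1)%N -> (2 <= tree_size S2)%N ->
     cvgn (tv S1 S2)) /\
  is_metric_on [set S : tree | (3 <= tree_size S)%N] d.
Proof.
move=> tv d.
have cvg_tv S1 S2 : (2 <= tree_size S1)%N -> (2 <= tree_size S2)%N -> cvgn (tv S1 S2).
  by move=> h1 h2; apply: (tv_seq_cvg h1 h2); exact: T_lpam.
have d_sym S1 S2 : d S1 S2 = d S2 S1.
  rewrite /d (_ : tv S1 S2 = tv S2 S1) //; apply/funext => n; exact: tv_dist_sym.
have d_pos S1 S2 : (3 <= tree_size S1)%N -> (tree_size S1 <= tree_size S2)%N ->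
    S1 <> S2 -> 0 < d S1 S2.
  move=> S1_ge3 S12 S_neq; have S1_ge2 := ltnW S1_ge3.
  have S2_ge2 := leq_trans S1_ge2 S12.
  have [c c0 cP] := tv_seq_separates S1_ge3 S12 S_neq (T_lpam _ S1_ge2) (T_lpam _ S2_ge2).
  apply: lt_le_trans c0 _; apply: limr_ge; first exact: cvg_tv.
  by exists (tree_size S2) => // n; exact: cP.
split=> //; split.
- move=> x y /ltnW x2 /ltnW y2; apply: limr_ge; first exact: cvg_tv.
  by apply: nearW => n; exact: tv_dist_ge0.
- move=> x y x3 y3; split => [dxy|->].
    (* [d_pos] wants the smaller seed first; symmetry gives the other order. *)
    apply: contrapT => xy; have [xley|/ltnW ylex] := leqP (tree_size x) (tree_size y).
      by have := d_pos x y x3 xley xy; rewrite dxy ltxx.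
    have yx : y <> x by move=> yx; apply: xy.
    by have := d_pos y x y3 ylex yx; rewrite d_sym dxy ltxx.
  (* Both sides are the same process, so the distance is 0 at every time. *)
  rewrite /d (_ : tv y y = fun=> 0); first exact: lim_cst.
  by apply/funext => n; exact: tv_dist_self.
- by move=> x y _ _; exact: d_sym.
- move=> x y z /ltnW x2 /ltnW y2 /ltnW z2.
  rewrite /d -limD; [|exact: cvg_tv|exact: cvg_tv].
  apply: ler_lim; first exact: cvg_tv.
    by apply: is_cvgD; exact: cvg_tv.
  by apply: nearW => n; exact: tv_dist_triangle.
Qed.
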